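(* Let $X=\operatorname{Spec} B$ be a factorial complex affine variety of dimension $\ge 3$ with a $G_a$-action corresponding to an irreducible locally nilpotent derivation $\delta$ on $B$. Suppose that $A=\ker\delta$ is an affine $\mathbb{C}$-domain and that the quotient morphism $\pi : X\to Y=\operatorname{Spec} A$ is faithfully flat. Then the following assertions are equivalent. (1) The quotient morphism $\pi$ is a trivial $\mathbb{A}^1$-bundle. (2) There exists a closed subset $V(\alpha)$ of $Y$ of codimension one (with $\alpha\in A$) satisfying: (i) every closed fiber of $\pi$ over $Y\setminus V(\alpha)$ is isomorphic to $\mathbb{A}^1$; (ii) for every prime factor $f_i$ of $\alpha$ in $A$, the morphism $\tau_i : Z_i=\operatorname{Spec}\ker\delta_i\to V_Y(f_i)=\operatorname{Spec} A/f_iA$ induced by the inclusion $A/f_iA\hookrightarrow\ker\delta_i$ is birational, where $\delta_i$ is the locally nilpotent derivation on $B/f_iB$ induced by $\delta$.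
   Context: The ground field is $\mathbb{C}$; $G_a$ is the additive group $(\mathbb{C},+)$. An affine $\mathbb{C}$-domain is an integral domain finitely generated as a $\mathbb{C}$-algebra. An affine variety $X=\operatorname{Spec} B$ is factorial if $B$ is a UFD. Algebraic $G_a$-actions on $X=\operatorname{Spec}B$ correspond bijectively to locally nilpotent derivations (lnd) $\delta$ on $B$ ($\mathbb{C}$-derivations such that every $b\in B$ is killed by some power of $\delta$); the ring of invariants is $A=\ker\delta$, which is factorially closed in $B$ (so it is factorial if $B$ is, and a prime element of $A$ is prime in $B$). The quotient morphism $\pi: X\to Y=\operatorname{Spec}A$ is the morphism induced by $A\hookrightarrow B$. An lnd $\delta$ on $B$ is irreducible if $\delta(B)\subset bB$ with $b\in B$ implies $b\in B^*$. Fibers of $\pi$ are scheme-theoretic fibers. $\pi$ is a trivial $\mathbb{A}^1$-bundle if $X\cong Y\times\mathbb{A}^1$ over $Y$. The morphism $\tau_i$ is birational if it induces an isomorphism of the quotient fields $Q(A/f_iA)\to Q(\ker\delta_i)$. *)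

(* Defs.v *)
From HB Require Import structures.
From mathcomp Require Import all_boot all_algebra.
From mathcomp Require Import boolp reals complex.

Set Implicit Arguments.
Unset Strict Implicit.
Unset Printing Implicit Defensive.

Import GRing.Theory.

Local Open Scope ring_scope.
Local Open Scope quotient_scope.

Section Divisibility.
Variable R : comNzRingType.

Definition divides (x y : R) : Prop := exists z, y = x * z.

Definition is_unit (x : R) : Prop := exists y, x * y = 1.

Definition associated (x y : R) : Prop := exists2 u, is_unit u & y = u * x.

Definition irreducible_elt (x : R) : Prop :=
  [/\ x != 0, ~ is_unit x
    & forall y z, x = y * z -> is_unit y \/ is_unit z].

Definition prime_elt (x : R) : Prop :=
  [/\ x != 0, ~ is_unit x
    & forall y z, divides x (y * z) -> divides x y \/ divides x z].

Lemma prime_nonunit x : prime_elt x -> ~ is_unit x.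
Proof. by case. Qed.

Definition factorization (s : seq R) (x : R) : Prop :=
  (forall y, y \in s -> irreducible_elt y) /\ x = \prod_(y <- s) y.

Definition factorial_ring : Prop :=
  [/\ GRing.integral_domain_axiom R,
      forall x, x != 0 -> ~ is_unit x -> exists s, factorization s x
    & forall s t x, factorization s x -> factorization t x ->
      exists t', [/\ perm_eq t' t, size s = size t'
                   & forall i, (i < size s)%N -> associated s`_i t'`_i]].

End Divisibility.

Section Spectrum.
Variable R : comNzRingType.

Definition strict_subideal (p q : prime_idealr R) : Prop :=
  {subset p <= q} /\ ~ {subset q <= p}.

Definition prime_chain (n : nat) (p : nat -> prime_idealr R) : Prop :=
  forall i, (i < n)%N -> strict_subideal (p i) (p i.+1).

Definition krull_dim_ge (n : nat) : Prop := exists p, prime_chain n p.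

Definition height_ge (q : prime_idealr R) (n : nat) : Prop :=
  exists2 p, prime_chain n p & p n =i q.

Definition height_eq (q : prime_idealr R) (n : nat) : Prop :=
  height_ge q n /\ ~ height_ge q n.+1.

(* The codimension of a closed subset is the infimum of the codimensions of its
   irreducible closed subsets, i.e. of the heights of the primes it contains;
   in particular the empty set has no finite codimension. *)
Definition codim_V (a : R) (n : nat) : Prop :=
  (exists2 q : prime_idealr R, a \in q & height_eq q n) /\
  (forall q : prime_idealr R, a \in q -> height_ge q n).

Definition maximal_idealr (m : idealr R) : Prop :=
  forall I : idealr R, {subset m <= I} -> {subset I <= m}.

End Spectrum.

Definition finitely_generated (k : fieldType) (B : comAlgType k) : Prop :=
  exists s : seq B,
    forall S : subalgClosed B, {subset s <= S} -> forall b, b \in S.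

Definition affine_domain (k : fieldType) (B : comAlgType k) : Prop :=
  finitely_generated B /\ GRing.integral_domain_axiom B.

Section PrincipalIdeal.
Variables (R : comNzRingType) (f : R) (hf : ~ is_unit f).

(* The argument [hf] is what makes the ideal proper, as [idealr] requires. *)
Definition principal of ~ is_unit f : {pred R} := fun x => `[< divides f x >].

Lemma principal_idealr_closed : idealr_closed (principal hf).
Proof.
split; rewrite ?unfold_in.
- by apply/asboolP; exists 0; rewrite mulr0.
- by apply/asboolP => -[z e]; apply: hf; exists z.
- move=> a u v /asboolP[x ->] /asboolP[y ->].
  by rewrite unfold_in; apply/asboolP; exists (a * x + y); rewrite mulrDr mulrCA.
Qed.

HB.instance Definition _ := isIdealr.Build R (principal hf) principal_idealr_closed.

End PrincipalIdeal.

Section QuotientAlgebra.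
Variables (k : fieldType) (B : comAlgType k) (I : idealr B).

Local Notation Q := (Quotient.quot I).

Definition quot_scale (a : k) (x : Q) : Q := \pi_Q (a%:A * repr x).

Lemma quot_scaleE a (x : B) : quot_scale a (\pi_Q x) = \pi_Q (a *: x).
Proof.
rewrite /quot_scale; apply/eqP; rewrite -Quotient.idealrBE.
rewrite -[a *: x]mul1r -scalerAr scalerAl -mulrBr idealMr //.
by rewrite Quotient.idealrBE reprK.
Qed.

Lemma quot_scaleA a b x : quot_scale a (quot_scale b x) = quot_scale (a * b) x.
Proof. by rewrite -[x]reprK (quot_scaleE b) (quot_scaleE a) quot_scaleE scalerA. Qed.

Lemma quot_scale1 : left_id 1 quot_scale.
Proof. by move=> x; rewrite -[x]reprK quot_scaleE scale1r. Qed.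

Lemma quot_piD (x y : B) : \pi_Q (x + y) = \pi_Q x + \pi_Q y.
Proof. by rewrite !piE. Qed.

Lemma quot_piB (x y : B) : \pi_Q (x - y) = \pi_Q x - \pi_Q y.
Proof. by rewrite !piE. Qed.

Lemma quot_piM (x y : B) : \pi_Q (x * y) = \pi_Q x * \pi_Q y.
Proof. by rewrite !piE. Qed.

Lemma quot_scaleDr : right_distributive quot_scale +%R.
Proof.
move=> a x y; rewrite -[x]reprK -[y]reprK -quot_piD !quot_scaleE.
by rewrite -quot_piD scalerDr.
Qed.

Lemma quot_scaleDl v : {morph quot_scale^~ v : a b / a + b}.
Proof. by move=> a b; rewrite -[v]reprK !quot_scaleE -quot_piD scalerDl. Qed.

HB.instance Definition _ := GRing.Zmodule_isLmodule.Build k Q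
  quot_scaleA quot_scale1 quot_scaleDr quot_scaleDl.

Lemma quot_piZ (a : k) (x : B) : \pi_Q (a *: x) = a *: (\pi_Q x : Q).
Proof. by rewrite [RHS]quot_scaleE. Qed.

Lemma quot_scaleAl (a : k) (x y : Q) : a *: (x * y) = (a *: x) * y.
Proof.
by rewrite -[x]reprK -[y]reprK -quot_piM -!quot_piZ -quot_piM scalerAl.
Qed.

HB.instance Definition _ := GRing.Lmodule_isLalgebra.Build k Q quot_scaleAl.
HB.instance Definition _ := GRing.Lalgebra_isComAlgebra.Build k Q.

End QuotientAlgebra.

Record derivation (k : fieldType) (B : comAlgType k) := Derivation {
  der_fun :> {linear B -> B};
  derM : forall x y, der_fun (x * y) = der_fun x * y + x * der_fun y }.

Section Derivations.
Variables (k : fieldType) (B : comAlgType k) (d : derivation B).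

Definition locally_nilpotent : Prop := forall b, exists n, iter n d b = 0.

Definition irreducible_der : Prop :=
  forall b, (forall x, divides b (d x)) -> is_unit b.

Definition derker_pred : {pred B} := fun b => d b == 0.

Lemma der1 : d 1 = 0.
Proof.
apply: (addrI (d 1)); rewrite addr0.
by have := derM d 1 1; rewrite !mulr1 mul1r => <-.
Qed.

Lemma derker_pred_subalg : subalg_closed derker_pred.
Proof.
split=> [|a x y|x y]; rewrite !unfold_in ?der1 //.
  by move=> /eqP dx /eqP dy; rewrite linearP dx dy scaler0 addr0.
by move=> /eqP dx /eqP dy; rewrite derM dx dy mulr0 mul0r addr0.
Qed.

HB.instance Definition _ :=
  GRing.isSubalgClosed.Build k B derker_pred derker_pred_subalg.

Record derker := Derker { derker_val :> B; _ : derker_val \in derker_pred }.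

HB.instance Definition _ := [isSub for derker_val].
HB.instance Definition _ := [Choice of derker by <:].
HB.instance Definition _ := [SubChoice_isSubComNzRing of derker by <:].
HB.instance Definition _ := [SubZmodule_isSubLmodule of derker by <:].
HB.instance Definition _ := [SubNzRing_SubLmodule_isSubLalgebra of derker by <:].
HB.instance Definition _ := [SubLalgebra_isSubAlgebra of derker by <:].

Definition derker_incl (a : derker) : B := \val a.

HB.instance Definition _ :=
  GRing.RMorphism.copy derker_incl (\val : derker -> B).
HB.instance Definition _ := GRing.Linear.copy derker_incl (\val : derker -> B).

Lemma derkerE (a : derker) : d (\val a) = 0.
Proof. exact/eqP/(valP a). Qed.

Lemma derker_nonunit (f : derker) : ~ is_unit f -> ~ is_unit (derker_incl f).
Proof.
move=> nf [b fb]; apply: nf.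
have db : d b = 0.
  have : d (\val f * b) = 0 by rewrite fb der1.
  rewrite derM derkerE mul0r add0r => /(congr1 ( *%R b)).
  by rewrite mulrA [b * _]mulrC fb mul1r mulr0.
have kb : b \in derker_pred by rewrite unfold_in db.
by exists (Derker kb); apply: val_inj; rewrite rmorphM rmorph1.
Qed.

End Derivations.

Arguments derker_incl {k B} d a.

Section InducedDerivation.
Variables (k : fieldType) (B : comAlgType k) (d : derivation B).
Variables (f : derker d) (hf : ~ is_unit f).

Definition idealA : idealr (derker d) := principal hf.
Definition idealB : idealr B := principal (derker_nonunit hf).

Local Notation QA := {ideal_quot idealA}.
Local Notation QB := {ideal_quot idealB}.

Definition induced_fun (x : QB) : QB := \pi_QB (d (repr x)).

Lemma induced_funE (b : B) : induced_fun (\pi_QB b) = \pi_QB (d b).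
Proof.
rewrite /induced_fun; apply/eqP; rewrite -Quotient.idealrBE -linearB /=.
have : repr (\pi_QB b) - b \in idealB by rewrite Quotient.idealrBE reprK.
rewrite !unfold_in => /asboolP[z ->]; apply/asboolP; exists (d z).
by rewrite derM derkerE mul0r add0r.
Qed.

Lemma induced_linear : linear induced_fun.
Proof.
move=> a x y; rewrite -[x]reprK -[y]reprK -quot_piZ -quot_piD.
by rewrite !induced_funE linearP quot_piD quot_piZ.
Qed.

HB.instance Definition _ := GRing.isLinear.Build k QB QB _ induced_fun induced_linear.

Lemma induced_derM (x y : QB) :
  induced_fun (x * y) = induced_fun x * y + x * induced_fun y.
Proof.
rewrite -[x]reprK -[y]reprK -quot_piM !induced_funE derM.
by rewrite quot_piD !quot_piM.
Qed.

Definition induced_der : derivation QB :=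
  @Derivation k QB induced_fun induced_derM.

Lemma tau_subproof (x : QA) :
  \pi_QB (derker_incl d (repr x)) \in derker_pred induced_der.
Proof.
by rewrite unfold_in [_ (\pi _)]induced_funE derkerE; apply/eqP; rewrite !piE.
Qed.

Definition tau_fun (x : QA) : derker induced_der := Derker (tau_subproof x).

Lemma tau_funE (a : derker d) :
  \val (tau_fun (\pi_QA a)) = \pi_QB (derker_incl d a).
Proof.
apply/eqP; rewrite -Quotient.idealrBE -rmorphB.
have : repr (\pi_QA a) - a \in idealA by rewrite Quotient.idealrBE reprK.
rewrite !unfold_in => /asboolP[z ->]; apply/asboolP; exists (derker_incl d z).
by rewrite rmorphM.
Qed.

Lemma tau_zmod_morphism : zmod_morphism tau_fun.
Proof.
move=> x y; apply: val_inj; rewrite -[x]reprK -[y]reprK.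
rewrite -quot_piB tau_funE !rmorphB.
by congr (_ - _); apply: esym; apply: tau_funE.
Qed.

Lemma tau_monoid_morphism : monoid_morphism tau_fun.
Proof.
split=> [|x y]; apply: val_inj.
  by rewrite -[1 : QA](rmorph1 \pi_QA) tau_funE !rmorph1.
rewrite -[x]reprK -[y]reprK.
rewrite -quot_piM tau_funE !rmorphM.
by congr (_ * _); apply: esym; apply: tau_funE.
Qed.

HB.instance Definition _ :=
  GRing.isZmodMorphism.Build QA (derker induced_der) tau_fun tau_zmod_morphism.
HB.instance Definition _ :=
  GRing.isMonoidMorphism.Build QA (derker induced_der) tau_fun
    tau_monoid_morphism.

Definition tau : {rmorphism QA -> derker induced_der} := tau_fun.

End InducedDerivation.

(* [domain_of hR] is R with the unit-ring structure, classically defined, that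
   [fraction] needs. *)
Definition domain_of (R : comNzRingType) of GRing.integral_domain_axiom R : Type :=
  R.

Section DomainOf.
Variables (R : comNzRingType) (hR : GRing.integral_domain_axiom R).

HB.instance Definition _ := GRing.ComNzRing.on (domain_of hR).

Definition domain_unit : {pred domain_of hR} := fun x => `[< is_unit (x : R) >].

Definition domain_inv (x : domain_of hR) : domain_of hR :=
  if pselect (is_unit (x : R)) is left h then projT1 (cid h) else x.

Lemma domain_mulVx : {in domain_unit, left_inverse 1 domain_inv *%R}.
Proof.
move=> x; rewrite unfold_in => /asboolP h; rewrite /domain_inv.
by case: pselect => // h'; case: cid => y /= e; rewrite mulrC.
Qed.

Lemma domain_unitP x y : y * x = 1 -> domain_unit x.
Proof. by move=> e; apply/asboolP; exists y; rewrite mulrC. Qed.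

Lemma domain_invr_out : {in [predC domain_unit], domain_inv =1 id}.
Proof.
move=> x; rewrite !unfold_in => /asboolPn h.
by rewrite /domain_inv; case: pselect.
Qed.

HB.instance Definition _ := GRing.ComNzRing_hasMulInverse.Build (domain_of hR)
  domain_mulVx domain_unitP domain_invr_out.
HB.instance Definition _ := GRing.ComUnitRing_isIntegral.Build (domain_of hR) hR.

End DomainOf.

Definition birational (R S : comNzRingType) (phi : {rmorphism R -> S}) : Prop :=
  exists (hR : GRing.integral_domain_axiom R)
         (hS : GRing.integral_domain_axiom S)
         (g : {rmorphism {fraction (domain_of hR)} ->
                         {fraction (domain_of hS)}}),
    (forall x : R, g (tofrac (x : domain_of hR)) =
                   tofrac (phi x : domain_of hS)) /\
    bijective g.

Section Tensor.
Variable A : comNzRingType.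

Definition balanced (M N : lmodType A) (P : zmodType) (b : M -> N -> P) : Prop :=
  [/\ forall m, {morph b m : n n' / n + n'},
      forall n, {morph b^~ n : m m' / m + m'}
    & forall a m n, b (a *: m) n = b m (a *: n)].

(* A list of pairs (m, n) stands for the sum of the m (x) n. By the universal
   property of the tensor product, two such sums are equal in it exactly when
   every balanced map takes the same value on them. *)
Definition tensor_rel (M N : lmodType A) (s t : seq (M * N)) : bool :=
  `[< forall (P : zmodType) (b : M -> N -> P), balanced b ->
      \sum_(x <- s) b x.1 x.2 = \sum_(x <- t) b x.1 x.2 >].

Lemma tensor_rel_equiv M N : equiv_class_of (@tensor_rel M N).
Proof.
split=> [s|s t|t s u].
- exact/asboolP.
- by apply/asboolP/asboolP => h P b /h ->.
- move=> /asboolP h1 /asboolP h2; apply/asboolP => P b hb.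
  by rewrite h1 // h2.
Qed.

Canonical tensor_equiv M N := EquivRelPack (@tensor_rel_equiv M N).
Canonical tensor_encModRel M N := defaultEncModRel (@tensor_rel M N).

Definition tensor (M N : lmodType A) : Type := {eq_quot (@tensor_rel M N)}.
HB.instance Definition _ M N :=
  EqQuotient.on (tensor M N).
HB.instance Definition _ M N := Choice.on (tensor M N).

Definition tensor_map (M M' N : lmodType A) (u : {linear M -> M'})
    (t : tensor M N) : tensor M' N :=
  \pi_(tensor M' N) [seq (u x.1, x.2) | x <- repr t].

Lemma tensor_mapE (M M' N : lmodType A) (u : {linear M -> M'}) s :
  tensor_map u (\pi_(tensor M N) s) =
  \pi_(tensor M' N) [seq (u x.1, x.2) | x <- s].
Proof.
have e : tensor_rel (repr (\pi_(tensor M N) s)) s.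
  by rewrite -(eqquotE (tensor M N)) reprK.
apply/eqP; rewrite eqquotE; apply/asboolP => P b [b1 b2 b3]; rewrite !big_map.
move/asboolP: e => /(_ P (fun m n => b (u m) n)); apply; split.
- by move=> m n n'; rewrite b1.
- by move=> n m m'; rewrite raddfD b2.
- by move=> a m n; rewrite linearZ b3.
Qed.

Definition flat_module (N : lmodType A) : Prop :=
  forall (M M' : lmodType A) (u : {linear M -> M'}),
    injective u -> injective (@tensor_map M M' N u).

End Tensor.

Section RestrictScalars.
Variables (A B : comNzRingType) (phi : {rmorphism A -> B}).

Definition restrict_scalars of {rmorphism A -> B} : Type := B.
Local Notation N := (restrict_scalars phi).

HB.instance Definition _ := GRing.Zmodule.on N.

Definition restrict_scale (a : A) (b : N) : N := phi a * (b : B).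

Lemma restrict_scaleA a b v :
  restrict_scale a (restrict_scale b v) = restrict_scale (a * b) v.
Proof. by rewrite /restrict_scale rmorphM mulrA. Qed.

Lemma restrict_scale1 : left_id 1 restrict_scale.
Proof. by move=> v; rewrite /restrict_scale rmorph1 mul1r. Qed.

Lemma restrict_scaleDr : right_distributive restrict_scale +%R.
Proof. by move=> a u v; rewrite /restrict_scale mulrDr. Qed.

Lemma restrict_scaleDl v : {morph restrict_scale^~ v : a b / a + b}.
Proof. by move=> a b; rewrite /restrict_scale rmorphD mulrDl. Qed.

HB.instance Definition _ := GRing.Zmodule_isLmodule.Build A N
  restrict_scaleA restrict_scale1 restrict_scaleDr restrict_scaleDl.

End RestrictScalars.

Section Morphisms.
Variables (A B : comNzRingType) (phi : {rmorphism A -> B}).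

Definition spec_surjective : Prop :=
  forall p : prime_idealr A, exists q : prime_idealr B,
    forall a, (a \in p) = (phi a \in q).

Definition faithfully_flat : Prop :=
  flat_module (restrict_scalars phi) /\ spec_surjective.

Definition trivial_A1_bundle : Prop :=
  exists g : {rmorphism {poly A} -> B},
    (forall a, g a%:P = phi a) /\ bijective g.

Definition extended_ideal (m : idealr A) (b : B) : Prop :=
  exists (n : nat) (a : 'I_n -> A) (c : 'I_n -> B),
    (forall i, a i \in m) /\ b = \sum_(i < n) phi (a i) * c i.

End Morphisms.

(* The fibre over the closed point m is Spec B/mB. It is isomorphic to the
   affine line only if mB is proper, which [idealr] requires of I. *)
Definition fiber_is_A1 (k : fieldType) (A B : comAlgType k)
    (phi : {lrmorphism A -> B}) (m : idealr A) : Prop :=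
  exists2 I : idealr B, (forall b, b \in I <-> extended_ideal phi m b) &
    exists g : {lrmorphism {ideal_quot I} -> {poly k}}, bijective g.

(* Main.v *)
Require Import Defs.
From HB Require Import structures.
From mathcomp Require Import all_boot all_algebra.
From mathcomp Require Import boolp classical_sets reals complex.

Set Implicit Arguments.
Unset Strict Implicit.
Unset Printing Implicit Defensive.

Import GRing.Theory.
Local Open Scope ring_scope.
Local Open Scope quotient_scope.

(** Both conditions amount to the existence of a slice, an element s with
    delta s = 1. Indeed a slice integrates every element of B to a
    polynomial in s over A = ker delta, so that B = A[s] ([slice_trivial]).
    Conversely, if B = A[x], the chain rule makes delta x a common divisor
    of all derivatives; it is a unit because delta is irreducible, units are
    constants, and x can be rescaled to a slice ([trivial_slice]).

    From a slice to the second condition. Evaluating the coefficients of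
    polynomials in s at a closed point of Spec A, which has residue field C
    by the Nullstellensatz ([maximal_point]), presents the fibre as C[t]
    ([slice_fibre]); and if the derivative of p(s) vanishes modulo a prime f
    of A, then p is constant modulo f, so that every tau, which is
    injective, is bijective ([slice_tau_surj]). Thus alpha may be any prime
    element of A. There is one because A is not a field: otherwise B = A[s]
    would have dimension one ([slice_dim_le1]).

    From the second condition to a slice. The claim is that for every prime
    f of A, an element x of B with delta x in fB is a fraction modulo f:
    c x - h lies in fB for some constants c and h (elements of A), with c not
    divisible by f.
    When f divides alpha this is the surjectivity of the map of function
    fields ([birational_fraction]). Otherwise suppose that x is not a
    fraction modulo f. Two morphisms B/fB -> C can then be found which agree
    on A/fA, at a point outside V(alpha), but take different values at x and
    do not kill a chosen derivative delta b. They factor through the same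
    fibre of pi, a line C[t] on which delta induces a nonzero derivation
    annihilating x; so x is a scalar there and the two values agree, a
    contradiction ([generic_fibre_fraction]). The morphisms come from a
    generic extension result for morphisms to an algebraically closed field,
    proved by adjoining one generator at a time ([extend_generated],
    [extend_step_avoiding]).

    Finally, let delta s = f a with f a prime of A and a in A, and write
    c s = h + f t as above. The element h of A lies in (c, f)B, hence in (c, f)A
    because faithfully flat extensions contract extended ideals back
    ([faithfully_flat_contraction]); with h = c c1 + f c2 the prime f
    divides c (s - c1), hence s - c1, and (s - c1)/f has derivative a
    ([plinth_divide]). Starting from a local slice, whose derivative is a
    product of primes of A since A is factorially closed, all the prime
    factors are removed in turn ([slice_of_fractions]). *)

(** * Integral domains *)

Section DomainFacts.
Variables (R : comNzRingType) (hR : GRing.integral_domain_axiom R).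
Implicit Types x y z : R.

Lemma dom_mul_neq0 x y : x != 0 -> y != 0 -> x * y != 0.
Proof.
move=> x0 y0; apply/eqP => /hR /orP[] e; first by rewrite e in x0.
by rewrite e in y0.
Qed.

Lemma dom_mulfI x y z : x != 0 -> x * y = x * z -> y = z.
Proof.
move=> x0 e; have : x * (y - z) = 0 by rewrite mulrBr e subrr.
by move=> /hR; rewrite (negbTE x0) subr_eq0 => /eqP.
Qed.

Lemma dom_exp_neq0 x n : x != 0 -> x ^+ n != 0.
Proof.
move=> x0; elim: n => [|n IH]; first by rewrite expr0 oner_neq0.
by rewrite exprS dom_mul_neq0.
Qed.

End DomainFacts.

(** * Morphisms out of a simple extension *)

Section SimpleExtension.
Variables (T T' : comNzRingType) (phi : {rmorphism T -> T'}).
Hypotheses (hT' : GRing.integral_domain_axiom T') (phi_inj : injective phi).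

Local Notation ev x p := ((map_poly phi p).[x]).

Lemma sub_domain : GRing.integral_domain_axiom T.
Proof.
move=> x y e; have /hT' : phi x * phi y = 0 by rewrite -rmorphM e rmorph0.
by case/orP => /eqP e0; apply/orP; [left|right]; apply/eqP/phi_inj; rewrite e0 rmorph0.
Qed.

(** A minimal polynomial over the fraction field of T, up to a scalar: over T
    itself a monic one need not exist. *)
Definition minimal_at x (P : {poly T}) : Prop :=
  [/\ P != 0, ev x P = 0
    & forall p : {poly T}, (size p < size P)%N -> ev x p = 0 -> p = 0].

Lemma minimal_exists x :
  (exists2 p : {poly T}, p != 0 & ev x p = 0) -> exists P, minimal_at x P.
Proof.
case=> p p0 ep.
have ex : exists n, `[< exists q : {poly T}, [/\ size q = n, q != 0 & ev x q = 0] >].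
  by exists (size p); apply/asboolP; exists p.
case: (ex_minnP ex) => n /asboolP[P [sP P0 eP]] min; exists P; split=> // q sq eq.
apply/eqP/negPn/negP => q0.
have /min : `[< exists q' : {poly T}, [/\ size q' = size q, q' != 0 & ev x q' = 0] >].
  by apply/asboolP; exists q.
by rewrite -sP leqNgt sq.
Qed.

Lemma minimal_size x P : minimal_at x P -> (1 < size P)%N.
Proof.
case=> P0 eP _; rewrite ltnNge; apply/negP => /size1_polyC e.
move: eP P0; rewrite e map_polyC hornerC => /eqP.
by rewrite polyC_eq0 -(rmorph0 phi) (inj_eq phi_inj) => ->.
Qed.

(** Since P(x) = 0, dividing P by p leaves a remainder of smaller degree than p
    whose value at x is a multiple of p(x). Euclid's algorithm thus descends to a
    constant, unless a remainder vanishes at x. *)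
Lemma alg_inverse_small x P (p : {poly T}) :
  minimal_at x P -> (size p < size P)%N -> ev x p != 0 ->
  exists (q : {poly T}) (r : T), r != 0 /\ ev x p * ev x q = phi r.
Proof.
move=> mP; have [P0 eP min] := mP; have hT := sub_domain.
elim: {p}(size p) {-2}p (leqnn (size p)) => [|n IH] p sp spP ep.
  by move: sp ep; rewrite leqn0 size_poly_eq0 => /eqP->; rewrite rmorph0 horner0 eqxx.
have p0 : p != 0 by apply: contraNneq ep => ->; rewrite rmorph0 horner0.
have [sP|sP] := leqP (size p) 1.
  move/size1_polyC: sP ep => ->; rewrite map_polyC hornerC => ep.
  exists 1, p`_0; rewrite rmorph1 hornerC mulr1; split=> //.
  by apply/eqP => e; move: ep; rewrite e raddf0 eqxx.
have := Pdiv.ComRing.rdivp_eq p P.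
set a := _ ^+ _; set q := Pdiv.Ring.rdivp _ _; set r := Pdiv.Ring.rmodp _ _ => dP.
have a0 : a != 0 by apply: dom_exp_neq0; rewrite ?lead_coef_eq0.
have sr : (size r < size p)%N by rewrite Pdiv.Ring.ltn_rmodp.
have evP : ev x p * ev x q + ev x r = 0.
  have := congr1 (fun g => ev x g) dP.
  rewrite -mul_polyC rmorphM /= rmorphD rmorphM /= !hornerM hornerD hornerM eP mulr0.
  by rewrite [_ * ev x p]mulrC => <-.
have [er|er] := eqVneq (ev x r) 0; last first.
  have [|||q' [c [c0 e]]] := IH r => //.
  - by rewrite -ltnS (leq_trans sr).
  - exact: ltn_trans spP.
  exists (- (q * q')), c; split=> //.
  rewrite rmorphN rmorphM /= hornerN hornerM mulrN mulrA.
  by move/eqP: evP; rewrite addr_eq0 => /eqP->; rewrite mulNr opprK.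
(* r(x) = 0 makes r vanish, so that P splits as q * p up to a constant, and q
   or p would be of smaller degree than P and vanish at x *)
have r0 : r = 0 by apply: min => //; apply: ltn_trans spP.
have aP0 : a *: P != 0.
  apply/eqP => /polyP /(_ (size P).-1); rewrite coefZ coef0 => /eqP; apply/negP.
  by apply: dom_mul_neq0 => //; rewrite -lead_coefE lead_coef_eq0.
have q0 : q != 0 by apply: contraNneq aP0 => q0; rewrite dP q0 r0 mul0r addr0.
have eq0 : ev x q = 0.
  apply: (dom_mulfI hT' ep); rewrite mulr0; move: evP.
  by rewrite er addr0.
have sq : (size P <= size q)%N.
  by rewrite leqNgt; apply: contra q0 => sq; rewrite (min q).
have := size_scale_leq a P; rewrite dP r0 addr0 size_proper_mul; last first.
  by apply: dom_mul_neq0; rewrite ?lead_coef_eq0.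
move: sq sP; clear; case: (size p) => [|[|m]] // sq _.
rewrite !addnS /= => h.
by have := leq_ltn_trans (leq_addr m _) (leq_trans h sq); rewrite ltnn.
Qed.

(** The Bezout relation between p and the minimal polynomial, denominators
    cleared; p is first reduced modulo the latter. *)
Lemma alg_inverse x P (p : {poly T}) : minimal_at x P -> ev x p != 0 ->
  exists (q : {poly T}) (r : T), r != 0 /\ ev x p * ev x q = phi r.
Proof.
move=> mP ep; have [P0 eP min] := mP; have hT := sub_domain.
have := Pdiv.ComRing.rdivp_eq P p.
set a := _ ^+ _; set q := Pdiv.Ring.rdivp _ _; set r := Pdiv.Ring.rmodp _ _ => dp.
have a0 : a != 0 by apply: dom_exp_neq0; rewrite ?lead_coef_eq0.
have er : ev x r = phi a * ev x p.
  have := congr1 (fun g => ev x g) dp.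
  rewrite -mul_polyC rmorphM /= rmorphD rmorphM /= !hornerM hornerD hornerM eP mulr0.
  by rewrite add0r map_polyC hornerC.
have [||q' [c [c0 e]]] := @alg_inverse_small x P r mP.
- by rewrite Pdiv.Ring.ltn_rmodp.
- rewrite er dom_mul_neq0 //; apply: contraNneq a0 => e.
  by apply/eqP/phi_inj; rewrite e rmorph0.
exists (a *: q'), c; split=> //.
by rewrite map_polyZ hornerZ mulrCA mulrA -er.
Qed.

Lemma minimal_dvd x P (p : {poly T}) : minimal_at x P -> ev x p = 0 ->
  exists n q, lead_coef P ^+ n *: p = q * P.
Proof.
move=> [P0 eP min] ep.
have dp := Pdiv.ComRing.rdivp_eq P p.
exists (Pdiv.Ring.rscalp p P), (Pdiv.Ring.rdivp p P); rewrite dp.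
rewrite [Pdiv.Ring.rmodp _ _]min ?addr0 ?Pdiv.Ring.ltn_rmodp //.
have := congr1 (fun g => ev x g) dp.
rewrite -mul_polyC rmorphM /= rmorphD rmorphM /= !hornerM hornerD hornerM eP ep !mulr0.
by rewrite add0r => <-.
Qed.

Section Extend.
Variable x : T'.
Hypothesis gen : forall y, exists p, y = ev x p.

(** The universal property of [T[x]]: the relations satisfied by [x] are the
    only obstruction to choosing its image. *)
Lemma extend_at (S : comNzRingType) (chi : {rmorphism T -> S}) (c : S) :
  (forall p, ev x p = 0 -> (map_poly chi p).[c] = 0) ->
  exists chi' : {rmorphism T' -> S},
    (forall p, chi' (ev x p) = (map_poly chi p).[c]).
Proof.
move=> rel.
pose f y := (map_poly chi (projT1 (cid (gen y)))).[c].
have fE p : f (ev x p) = (map_poly chi p).[c].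
  rewrite /f; case: cid => q /= e; apply/eqP; rewrite -subr_eq0 -hornerN -hornerD.
  by rewrite -rmorphB /= rel // rmorphB hornerD hornerN e subrr.
have fB : zmod_morphism f.
  move=> y z; have [[p ->] [q ->]] := (gen y, gen z).
  by rewrite -hornerN -hornerD -rmorphB !fE rmorphB hornerD hornerN.
have fM : monoid_morphism f.
  split=> [|y z].
    by have := fE 1; rewrite !rmorph1 -polyC1 !hornerC.
  have [[p ->] [q ->]] := (gen y, gen z).
  by rewrite -hornerM -rmorphM !fE rmorphM hornerM.
pose am := GRing.isZmodMorphism.Build _ _ f fB.
pose mm := GRing.isMonoidMorphism.Build _ _ f fM.
pose g : {rmorphism T' -> S} := HB.pack f am mm.
by exists g.
Qed.

Variable k : closedFieldType.

Lemma ev_polyC a : ev x a%:P = phi a.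
Proof. by rewrite map_polyC hornerC. Qed.

Lemma ev_X : ev x 'X = x.
Proof. by rewrite map_polyX hornerX. Qed.

Definition extends (chi : {rmorphism T -> k}) (chi' : {rmorphism T' -> k}) :=
  forall a, chi' (phi a) = chi a.

Lemma extend_trans (p : {poly T}) (chi : {rmorphism T -> k}) (c : k) :
  (forall q : {poly T}, ev x q = 0 -> q = 0) -> (map_poly chi p).[c] != 0 ->
  exists chi', [/\ extends chi chi', chi' (ev x p) != 0 & chi' x = c].
Proof.
move=> tr pc; have [|chi' e] := @extend_at k chi c.
  by move=> q /tr ->; rewrite rmorph0 horner0.
exists chi'; split; last 2 first.
- by rewrite e.
- by rewrite -{1}ev_X e map_polyX hornerX.
by move=> a; rewrite -ev_polyC e map_polyC hornerC.
Qed.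

Lemma extend_alg P (p q : {poly T}) (r : T) (chi : {rmorphism T -> k}) (c : k) :
  minimal_at x P -> ev x p * ev x q = phi r ->
  chi (lead_coef P) != 0 -> chi r != 0 -> root (map_poly chi P) c ->
  exists chi', [/\ extends chi chi', (map_poly chi p).[c] != 0,
                   chi' (ev x p) != 0 & chi' x = c].
Proof.
move=> mP epq cP cr /rootP rc; have [|chi' e] := @extend_at k chi c.
  move=> g /(minimal_dvd mP)[n [h /(congr1 (fun f => (map_poly chi f).[c]))]].
  rewrite map_polyZ hornerZ rmorphM /= hornerM rc mulr0 rmorphXn => /eqP.
  by rewrite mulf_eq0 expf_eq0 (negbTE cP) andbF => /eqP.
have ext : extends chi chi'.
  by move=> a; rewrite -ev_polyC e map_polyC hornerC.
have vp : chi' (ev x p) != 0.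
  by apply: contraNneq cr => e0; rewrite -ext -epq rmorphM e0 mul0r.
exists chi'; split=> //; first by rewrite -e.
by rewrite -{1}ev_X e map_polyX hornerX.
Qed.

Lemma transcendental_or_minimal :
  (forall q : {poly T}, ev x q = 0 -> q = 0) \/ exists P, minimal_at x P.
Proof.
have [h|h] := pselect (exists2 q : {poly T}, q != 0 & ev x q = 0).
  by right; apply: minimal_exists.
left=> q eq; apply/eqP/negPn/negP => q0; apply: h; by exists q.
Qed.

(** One element u controls the extension: when x is transcendental, the leading
    coefficient of a polynomial p with p(x) = v, so that p does not specialize
    to zero; when x is algebraic, the leading coefficient of its minimal
    polynomial times a constant that v divides, so that a root exists and v
    cannot specialize to zero. *)
Lemma extend_step (v : T') : v != 0 -> exists2 u : T, u != 0 &
  forall chi : {rmorphism T -> k}, chi u != 0 ->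
  exists2 chi', extends chi chi' & chi' v != 0.
Proof.
have [p ->] := gen v; move=> vp.
have [tr|[P mP]] := transcendental_or_minimal.
  have p0 : p != 0 by apply: contraNneq vp => ->; rewrite rmorph0 horner0.
  exists (lead_coef p); first by rewrite lead_coef_eq0.
  move=> chi chi_p.
  have /closed_nonrootP[c /rootP/eqP nc] : map_poly chi p != 0.
    apply/eqP => /polyP/(_ (size p).-1); rewrite coef_map coef0 /= => /eqP.
    by apply/negP.
  by have [chi' [? ? _]] := extend_trans tr nc; exists chi'.
have [q [r [r0 e]]] := alg_inverse mP vp; have [P0 _ _] := mP.
exists (lead_coef P * r).
  by apply: dom_mul_neq0; rewrite ?lead_coef_eq0 //; apply: sub_domain.
move=> chi; rewrite rmorphM mulf_eq0 => /norP[chiP chir].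
have [|c rc] := closed_rootP (map_poly chi P) _.
  by rewrite size_map_poly_id0 // gtn_eqF // (minimal_size mP).
by have [chi' [? _ ? _]] := extend_alg mP e chiP chir rc; exists chi'.
Qed.

(** An element outside the fraction field of the base is not determined by the
    base: a transcendental one can be sent almost anywhere, and an algebraic one
    to any root of a polynomial of degree at least two, which remains separable
    if its derivative at x is also kept from specializing to zero. *)
Lemma extend_step_avoiding (v : T') : (forall n, n.+1%:R != 0 :> T) ->
  (forall b h : T, b != 0 -> phi b * x <> phi h) ->
  v != 0 -> exists2 u : T, u != 0 &
  forall (chi : {rmorphism T -> k}) (c0 : k), chi u != 0 ->
  exists chi', [/\ extends chi chi', chi' v != 0 & chi' x != c0].
Proof.
move=> char0 nfrac; have [p ->] := gen v; move=> vp; have hT := sub_domain.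
have [tr|[P mP]] := transcendental_or_minimal.
  have p0 : p != 0 by apply: contraNneq vp => ->; rewrite rmorph0 horner0.
  exists (lead_coef p); first by rewrite lead_coef_eq0.
  move=> chi c0 chi_p.
  (* the factor 'X - c0 excludes the value c0 *)
  have /closed_nonrootP[c] : map_poly chi p * ('X - c0%:P) != 0.
    rewrite mulf_eq0 polyXsubC_eq0 orbF.
    apply/eqP => /polyP/(_ (size p).-1); rewrite coef_map coef0 /= => /eqP.
    by apply/negP.
  rewrite rootM root_XsubC => /norP[/rootP/eqP nc cc0].
  have [chi' [? ? e]] := extend_trans tr nc; exists chi'; split=> //.
  by rewrite e.
have [q [r [r0 e]]] := alg_inverse mP vp; have [P0 eP min] := mP.
have sP2 : (2 < size P)%N.
  rewrite ltn_neqAle (minimal_size mP) andbT; apply/eqP => sP.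
  apply: (nfrac P`_1 (- P`_0)).
    by rewrite [P`_1](_ : _ = lead_coef P) ?lead_coef_eq0 // lead_coefE -sP.
  move: eP; rewrite horner_coef size_map_poly_id0; last first.
    apply: contraNneq (_ : lead_coef P != 0) => [e0|]; last by rewrite lead_coef_eq0.
    by apply/eqP/phi_inj; rewrite e0 rmorph0.
  rewrite -sP !big_ord_recl big_ord0 !coef_map /= expr0 expr1 addr0 mulr1 => /eqP.
  by rewrite addrC addr_eq0 rmorphN => /eqP.
have dP0 : P^`() != 0.
  apply/eqP => /polyP/(_ (size P).-2); rewrite coef0 coef_deriv.
  case: (size P) (lead_coefE P) sP2 => [|[|n]] //= lc _ /eqP; apply/negP.
  by rewrite -mulr_natr -lc dom_mul_neq0 ?lead_coef_eq0.
have evd : ev x P^`() != 0.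
  by apply: contra dP0 => /eqP/min -> //; rewrite lt_size_deriv.
have [qd [rd [rd0 ed]]] := alg_inverse mP evd.
exists (lead_coef P * r * rd).
  by do 2?[apply: dom_mul_neq0 => //]; rewrite lead_coef_eq0.
move=> chi c0; rewrite !rmorphM !mulf_eq0 => /norP[/norP[chiP chir] chird].
have sPc : size (map_poly chi P) = size P by rewrite size_map_poly_id0.
suff [c rc cc0] : exists2 c, root (map_poly chi P) c & c != c0.
  have [chi' [? _ ? ex]] := extend_alg mP e chiP chir rc; exists chi'; split=> //.
  by rewrite ex.
have [rc0|rc0] := boolP (root (map_poly chi P) c0); last first.
  have [|c rc] := closed_rootP (map_poly chi P) _.
    by rewrite sPc gtn_eqF // (minimal_size mP).
  by exists c => //; apply: contraNneq rc0 => <-.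
(* a root of the cofactor Q equal to c0 would make c0 a double root *)
have /factor_theorem[Q eQ] := rc0.
have [|c rc] := closed_rootP Q _.
  apply/eqP => sQ; move: sPc; rewrite eQ size_Mmonic ?monicXsubC //; last first.
    by rewrite -size_poly_eq0 sQ.
  by rewrite sQ size_XsubC /= => sP; rewrite -sP in sP2.
exists c; first by rewrite eQ rootM rc.
apply/eqP => cc0; have [_ [_ dc _ _]] := extend_alg mP ed chiP chird rc0.
case/eqP: dc; rewrite -deriv_map eQ derivM derivXsubC mulr1 !hornerE.
by rewrite subrr mulr0 add0r -cc0; apply/rootP.
Qed.

End Extend.
End SimpleExtension.

(** * Generic extension along a finitely generated domain *)

Section Adjoin.
Variables (T E : comNzRingType) (phi : {rmorphism T -> E}) (x : E).

Definition adjoin_pred : {pred E} :=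
  fun y => `[< exists p : {poly T}, y = (map_poly phi p).[x] >].

Lemma adjoin_subring : subring_closed adjoin_pred.
Proof.
split=> [|y z|y z]; rewrite ?unfold_in.
- by apply/asboolP; exists 1; rewrite rmorph1 -polyC1 hornerC.
- move=> /asboolP[p ->] /asboolP[q ->]; apply/asboolP; exists (p - q).
  by rewrite rmorphB hornerD hornerN.
- move=> /asboolP[p ->] /asboolP[q ->]; apply/asboolP; exists (p * q).
  by rewrite rmorphM hornerM.
Qed.

HB.instance Definition _ :=
  GRing.isSubringClosed.Build E adjoin_pred adjoin_subring.

Record adjoin := Adjoin { adjoin_val :> E; _ : adjoin_val \in adjoin_pred }.

HB.instance Definition _ := [isSub for adjoin_val].
HB.instance Definition _ := [Choice of adjoin by <:].
HB.instance Definition _ := [SubChoice_isSubComNzRing of adjoin by <:].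

Lemma adjoin_baseP a : phi a \in adjoin_pred.
Proof. by apply/asboolP; exists a%:P; rewrite map_polyC hornerC. Qed.

Lemma adjoin_genP : x \in adjoin_pred.
Proof. by apply/asboolP; exists 'X; rewrite map_polyX hornerX. Qed.

Definition adjoin_base (a : T) : adjoin := Adjoin (adjoin_baseP a).
Definition adjoin_gen : adjoin := Adjoin adjoin_genP.

Lemma adjoin_base_zmod : zmod_morphism adjoin_base.
Proof. by move=> a b; apply: val_inj; rewrite rmorphB /= rmorphB. Qed.

Lemma adjoin_base_monoid : monoid_morphism adjoin_base.
Proof.
by split=> [|a b]; apply: val_inj; rewrite ?rmorph1 ?rmorphM /= ?rmorph1 ?rmorphM.
Qed.

HB.instance Definition _ :=
  GRing.isZmodMorphism.Build T adjoin adjoin_base adjoin_base_zmod.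
HB.instance Definition _ :=
  GRing.isMonoidMorphism.Build T adjoin adjoin_base adjoin_base_monoid.

Lemma adjoin_generated (y : adjoin) :
  exists p : {poly T}, y = (map_poly adjoin_base p).[adjoin_gen].
Proof.
have /asboolP[p e] := valP y; exists p; apply: val_inj; rewrite e.
have <- := horner_map (val : {rmorphism adjoin -> E}) _ adjoin_gen; congr (_.[_]).
by rewrite -map_poly_comp.
Qed.

Lemma adjoin_base_inj : injective phi -> injective adjoin_base.
Proof. by move=> phi_inj a b /(congr1 val) /phi_inj. Qed.

Lemma adjoin_domain :
  GRing.integral_domain_axiom E -> GRing.integral_domain_axiom adjoin.
Proof. by move=> hE; apply: (sub_domain hE (phi := val)); apply: val_inj. Qed.

End Adjoin.

Definition ring_generated (T E : comNzRingType) (phi : {rmorphism T -> E})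
    (s : seq E) : Prop :=
  forall S : subringClosed E, (forall a, phi a \in S) -> {subset s <= S} ->
    forall y, y \in S.

(** Chevalley's theorem on images, in terms of points: adjoin the generators one
    at a time, each step passing on to the next a single element that must not
    specialize to zero. *)
Lemma extend_generated (k : closedFieldType) (E : comNzRingType)
    (hE : GRing.integral_domain_axiom E) (s : seq E) (T : comNzRingType)
    (phi : {rmorphism T -> E}) (v : E) :
  injective phi -> ring_generated phi s -> v != 0 ->
  exists2 u : T, u != 0 &
  forall chi : {rmorphism T -> k}, chi u != 0 ->
  exists2 chi' : {rmorphism E -> k}, extends phi chi chi' & chi' v != 0.
Proof.
elim: s T phi => [|x s IH] T phi phi_inj gen v0.
  (* with no generator left, E is T adjoined the redundant element 0 *)
  apply: (@extend_step _ _ phi hE phi_inj 0 _ k) => // y; apply/asboolP.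
  by apply: (gen (adjoin_pred phi 0)) => // a; apply: adjoin_baseP.
have [|u1 u10 ext1] := IH (adjoin phi x) val val_inj _ v0.
  move=> S hS sS; apply: gen => [a|y].
    exact: (hS (adjoin_base phi x a)).
  by rewrite inE => /orP[/eqP->|/sS//]; apply: (hS (adjoin_gen phi x)).
have [u u0 ext] := extend_step (adjoin_domain hE) (adjoin_base_inj phi_inj)
  (@adjoin_generated _ _ phi x) k u10.
exists u => // chi /ext[chi1 e1 /ext1[chi' e' n']]; exists chi' => // a.
by rewrite -e1 -e'.
Qed.

(** * Quotients, maximal ideals and closed points *)

Lemma idealr_of (R : comNzRingType) (P : R -> Prop) :
  P 0 -> ~ P 1 -> (forall a x y, P x -> P y -> P (a * x + y)) ->
  exists I : idealr R, forall x, x \in I <-> P x.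
Proof.
move=> P0 P1 PD; pose p : {pred R} := fun x => `[< P x >].
have pc : idealr_closed p.
  split; rewrite ?unfold_in; [exact/asboolP | exact/asboolP |].
  by move=> a x y /asboolP px /asboolP py; rewrite unfold_in; apply/asboolP/PD.
pose h := isIdealr.Build R p pc.
pose I : idealr R := HB.pack p h.
by exists I => x; rewrite unfold_in; split => /asboolP.
Qed.

Lemma prime_idealr_of (R : comNzRingType) (I : idealr R) :
  (forall x y, x * y \in I -> x \in I \/ y \in I) ->
  exists p : prime_idealr R, p =i I.
Proof.
move=> h; pose P : {pred R} := fun x => `[< x \in I >].
have PE x : (x \in P) = (x \in I) by apply/asboolP/idP.
have Pc : idealr_closed P.
  split=> [||a x y]; rewrite !PE ?rpred0 ?idealr1 //.
  by move=> Ix Iy; rewrite rpredD ?idealMr.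
have Pp : prime_idealr_closed P.
  by move=> x y; rewrite !PE => /h[]->; rewrite ?orbT.
pose hi := isIdealr.Build R P Pc.
pose hp := isPrimeIdealrClosed.Build R P Pp.
pose p : prime_idealr R := HB.pack P hi hp.
by exists p.
Qed.

Section Quot.
Variables (R : comNzRingType) (I : idealr R).
Local Notation Q := {ideal_quot I}.

Lemma quot_pi_eq0 (x : R) : ((\pi_Q x : Q) == 0) = (x \in I).
Proof. by rewrite -{2}[x]subr0 Quotient.idealrBE !piE. Qed.

Lemma quot_pi_surj (y : Q) : exists x : R, y = \pi_Q x.
Proof. by exists (repr y); rewrite reprK. Qed.

Lemma quot_lift (S : comNzRingType) (h : {rmorphism R -> S}) :
  (forall x, x \in I -> h x = 0) ->
  exists g : {rmorphism Q -> S}, forall x, g (\pi_Q x) = h x.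
Proof.
move=> h0; pose f (y : Q) := h (repr y).
have fE x : f (\pi_Q x) = h x.
  apply/eqP; rewrite -subr_eq0 -rmorphB; apply/eqP/h0.
  by rewrite Quotient.idealrBE reprK.
have fB : zmod_morphism f.
  move=> y z; have [[x ->] [x' ->]] := (quot_pi_surj y, quot_pi_surj z).
  by rewrite -rmorphB !fE rmorphB.
have fM : monoid_morphism f.
  split=> [|y z]; first by rewrite -(rmorph1 (\pi_Q)) fE rmorph1.
  have [[x ->] [x' ->]] := (quot_pi_surj y, quot_pi_surj z).
  by rewrite -rmorphM !fE rmorphM.
pose am := GRing.isZmodMorphism.Build _ _ f fB.
pose mm := GRing.isMonoidMorphism.Build _ _ f fM.
pose g : {rmorphism Q -> S} := HB.pack f am mm.
by exists g.
Qed.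
End Quot.

Section Maximal.
Variable R : comNzRingType.

Lemma maximal_inverse (m : idealr R) : maximal_idealr m ->
  forall a, a \notin m -> exists b, 1 - a * b \in m.
Proof.
move=> max a am; apply: contrapT => nb.
have [|||I hI] := @idealr_of R (fun x => exists b, x - a * b \in m).
- by exists 0; rewrite mulr0 subr0 rpred0.
- exact: nb.
- move=> c x y [b xb] [b' yb]; exists (c * b + b').
  have -> : c * x + y - a * (c * b + b') = c * (x - a * b) + (y - a * b').
    by rewrite mulrBr mulrDr opprD addrACA mulrCA.
  by rewrite rpredD // idealMr.
case/negP: am; apply: (max I) => [x xm|]; apply/hI.
  by exists 0; rewrite mulr0 subr0.
by exists 1; rewrite mulr1 subrr rpred0.
Qed.

Lemma maximal_prime (m : idealr R) : maximal_idealr m ->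
  exists p : prime_idealr R, p =i m.
Proof.
move=> max; apply: prime_idealr_of => x y xy.
have [xm|xm] := boolP (x \in m); [by left|right].
have [b xb] := maximal_inverse max xm.
have : y * (1 - x * b) + b * (x * y) \in m.
  by apply: rpredD; apply: idealMr.
by rewrite mulrBr mulr1 [b * _]mulrC mulrAC [x * b * y]mulrC subrK.
Qed.

Lemma maximal_exists (J : idealr R) :
  exists2 m : idealr R, maximal_idealr m & {subset J <= m}.
Proof.
(* the empty set is admitted so that the empty chain has an upper bound *)
pose P (X : set R) := ~ X 1 /\ forall z, X z ->
  (forall x, x \in J -> X x) /\ (forall a x y, X x -> X y -> X (a * x + y)).
have [F FP tot|M [[M1 MP] Mmax]] := @Zorn_bigcup R P.
  split=> [[X FX]|z [X FX Xz]]; first by have [] := FP _ FX.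
  have [_ /(_ _ Xz)[JX _]] := FP _ FX.
  split=> [x Jx|a x y [Y FY Yx] [Z FZ Zy]]; first by exists X => //; apply: JX.
  have [YZ|ZY] := tot _ _ FY FZ.
    have [_ /(_ _ Zy)[_ ZD]] := FP _ FZ.
    by exists Z => //; apply: ZD => //; apply: YZ.
  have [_ /(_ _ Yx)[_ YD]] := FP _ FY.
  by exists Y => //; apply: YD => //; apply: ZY.
have ideal_P (I : idealr R) : {subset J <= I} -> P [set x | x \in I]%classic.
  move=> JI; split=> /= [|z _]; first by rewrite idealr1.
  by split=> // a x y Ix Iy; rewrite rpredD ?idealMr.
have M0 : M 0.
  apply: contrapT => nM0.
  apply: Mmax (ideal_P J (fun _ => id)).
  split=> [x /MP[JM _]|/(_ 0)]; first by case: nM0; apply: JM; rewrite rpred0.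
  by rewrite /= rpred0 => /(_ isT)/nM0.
have [JM MD] := MP _ M0.
have [m hm] := @idealr_of R M M0 M1 MD.
exists m => [I mI x xI|x /JM /hm//].
apply: contrapT => xm; apply: Mmax (ideal_P I _); last first.
  by move=> y /JM /hm /mI.
split=> [y /hm/mI//|/(_ x xI)/hm//].
Qed.

End Maximal.

Section FinitelyGenerated.
Variables (k : fieldType) (B : comAlgType k).

(** Algebra generators remain generators, as a ring, of any quotient E of B over
    any base whose image contains the scalars; [extend_generated] is applied to
    several such bases of the same quotient. *)
Lemma finitely_generated_ring :
  finitely_generated B ->
  exists s : seq B, forall (T E : comNzRingType) (phi : {rmorphism T -> E})
    (h : {rmorphism B -> E}), (forall y, exists b, y = h b) ->
    (forall c : k, exists t, phi t = h c%:A) -> ring_generated phi (map h s).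
Proof.
case=> s gen; exists s => T E phi h hsurj hk S phiS sS y.
have [b ->] := hsurj y; pose P : {pred B} := fun b => `[< h b \in S >].
have PE x : (x \in P) = (h x \in S) by apply/asboolP/idP.
have Pc : subalg_closed P.
  split=> [|a x z|x z]; rewrite !PE ?rmorph1 ?rpred1 //.
    move=> hx hz; have [t e] := hk a.
    by rewrite -mulr_algl rmorphD rmorphM -e rpredD ?rpredM.
  by move=> hx hz; rewrite rmorphM rpredM.
pose m := GRing.isSubalgClosed.Build k B P Pc.
pose S' : subalgClosed B := HB.pack P m.
by rewrite -PE; apply: (gen S') => x xs; rewrite PE; apply: sS; apply: map_f.
Qed.

End FinitelyGenerated.

(** The weak Nullstellensatz: the identity of k extends to a morphism from A/m
    to k, which is injective because A/m is a field. *)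
Lemma maximal_point (k : closedFieldType) (A : comAlgType k) (m : idealr A) :
  finitely_generated A -> maximal_idealr m ->
  exists chi : {rmorphism A -> k},
    (forall c : k, chi c%:A = c) /\ forall a, (chi a == 0) = (a \in m).
Proof.
move=> /finitely_generated_ring[s gen] max.
pose Q := {ideal_quot m}; have [p pm] := maximal_prime max.
have hQ : GRing.integral_domain_axiom Q.
  move=> x y; have [[a ->] [b ->]] := (quot_pi_surj x, quot_pi_surj y).
  by rewrite -rmorphM => /eqP; rewrite !quot_pi_eq0 -!pm prime_idealrM.
pose phi : {rmorphism k -> Q} := \pi_Q \o in_alg A.
have [|||u u0 ext] := @extend_generated k Q hQ (map \pi_Q s) k phi 1.
- exact: fmorph_inj.
- by apply: gen => [y|c]; [exact: quot_pi_surj | exists c].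
- exact: oner_neq0.
have [//|chi e _] := ext idfun.
exists (chi \o \pi_Q); split=> [c|a]; first exact: e.
rewrite -quot_pi_eq0 /=; apply/eqP/eqP => [e0|->]; last by rewrite rmorph0.
apply/eqP; rewrite quot_pi_eq0; apply/negPn/negP => /(maximal_inverse max)[b].
rewrite -quot_pi_eq0 rmorphB rmorph1 subr_eq0 => /eqP /(congr1 chi).
by rewrite rmorph1 !rmorphM e0 mul0r => /eqP; rewrite oner_eq0.
Qed.

(** * Locally nilpotent derivations and slices *)

Lemma inj_surj_bij (T U : Type) (f : T -> U) :
  injective f -> (forall y, exists x, y = f x) -> bijective f.
Proof.
move=> finj fsurj; pose g y := projT1 (cid (fsurj y)).
have fg : cancel g f by move=> y; rewrite /g; case: cid.
by exists g => // x; apply: finj; rewrite fg.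
Qed.

Lemma deriv_eq0_const (T : comNzRingType) (p : {poly T}) :
  (forall n (a : T), a *+ n.+1 = 0 -> a = 0) -> p^`() = 0 -> p = (p`_0)%:P.
Proof.
move=> char0 dp; apply/polyP => -[|i]; rewrite coefC //=.
by apply: (char0 i); rewrite -coef_deriv dp coef0.
Qed.

Section Char0.
Variables (k : fieldType) (char0 : forall n, n.+1%:R != 0 :> k).

Lemma char0_torsion (V : lmodType k) n (a : V) : a *+ n.+1 = 0 -> a = 0.
Proof.
rewrite -scaler_nat => e; rewrite -[a]scale1r -(mulVf (char0 n)).
by rewrite -scalerA e scaler0.
Qed.

Lemma antiderivative (T : comAlgType k) (q : {poly T}) :
  exists p : {poly T}, p^`() = q.
Proof.
(* at i = 0 the coefficient vanishes, since the inverse of 0 is 0 *)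
exists (\poly_(i < (size q).+1) ((i%:R : k)^-1 *: q`_i.-1)).
apply/polyP => i; rewrite coef_deriv coef_poly ltnS /=.
case: ltnP => [_|/(nth_default 0)->]; last by rewrite mul0rn.
by rewrite -scaler_nat scalerA mulfV ?scale1r.
Qed.
End Char0.

Section DerivationFacts.
Variables (k : fieldType) (B : comAlgType k) (d : derivation B).

Lemma der_scalar (c : k) : d c%:A = 0.
Proof. by rewrite linearZ /= der1 scaler0. Qed.

Lemma derkerP (b : B) : d b = 0 -> exists a : derker d, derker_incl d a = b.
Proof.
move=> db; have kb : b \in derker_pred d by apply/eqP.
by exists (Derker kb).
Qed.

Lemma derker_inclE (a : derker d) : d (derker_incl d a) = 0.
Proof. exact: derkerE. Qed.

Lemma derker_incl_inj : injective (derker_incl d).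
Proof. exact: val_inj. Qed.

Lemma der_constM (a b : B) : d a = 0 -> d (a * b) = a * d b.
Proof. by move=> da; rewrite derM da mul0r add0r. Qed.

Lemma der_horner (T : comNzRingType) (phi : {rmorphism T -> B}) (x : B)
    (p : {poly T}) : (forall a, d (phi a) = 0) ->
  d (map_poly phi p).[x] = (map_poly phi p^`()).[x] * d x.
Proof.
move=> phi0; elim/poly_ind: p => [|p c IH].
  by rewrite deriv0 rmorph0 horner0 mul0r raddf0.
rewrite derivD derivM derivX derivC addr0 mulr1.
rewrite !rmorphD !rmorphM /= !map_polyX map_polyC !hornerE.
by rewrite raddfD /= phi0 addr0 derM IH mulrDl mulrAC.
Qed.

Section Lnd.
Hypotheses (char0 : forall n, n.+1%:R != 0 :> k)
  (hB : GRing.integral_domain_axiom B) (lnd : locally_nilpotent d).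

Lemma iter_der0 n : iter n d 0 = 0.
Proof. by elim: n => //= n ->; rewrite raddf0. Qed.

Lemma iter_derD n (x y : B) : iter n d (x + y) = iter n d x + iter n d y.
Proof. by elim: n => //= n ->; rewrite raddfD. Qed.

Lemma iter_der_constM n (x y : B) : d x = 0 -> iter n d (x * y) = x * iter n d y.
Proof. by move=> dx; elim: n => //= n ->; rewrite der_constM. Qed.

(** The Leibniz formula for an iterated derivative of order n + m, in which only
    one term survives. *)
Lemma iter_der_top n m (x y : B) : iter n.+1 d x = 0 -> iter m.+1 d y = 0 ->
  iter (n + m) d (x * y) = (iter n d x * iter m d y) *+ 'C(n + m, n).
Proof.
elim: {n m}(n + m)%N {-2}n {-2}m (erefl (n + m)%N) x y => [|N IH] n m.
  by move=> /eqP; rewrite addn_eq0 => /andP[/eqP-> /eqP->] x y _ _; rewrite bin0.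
case: n => [|n]; first by move=> _ x y dx _; rewrite bin0 iter_der_constM.
case: m => [|m] eN x y.
  rewrite addn0 => dx dy.
  by rewrite binn mulrC iter_der_constM // mulrC.
move=> dx dy; have e1 : (n + m.+1 = N)%N by move: eN; rewrite addSn => -[].
have e2 : (n.+1 + m = N)%N by rewrite addSnnS.
rewrite eN iterSr derM iter_derD -{1}e1 -{1}e2.
rewrite (IH n m.+1) // -?iterSr // (IH n.+1 m) // -?iterSr //.
by rewrite -mulrnDr e1 e2 binS addnC.
Qed.

Lemma nilpotency_order (b : B) : b != 0 ->
  exists n, iter n d b != 0 /\ iter n.+1 d b = 0.
Proof.
move=> b0; have [n] := lnd b; elim: n => [/eqP|n IH e]; first by rewrite (negbTE b0).
have [/IH//|nz] := eqVneq (iter n d b) 0; by exists n.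
Qed.

(** The constants are factorially closed, because the nilpotency order behaves
    as a degree: it is additive on products. *)
Lemma ker_factorially_closed (x y : B) : x * y != 0 -> d (x * y) = 0 -> d x = 0.
Proof.
move=> xy0 dxy.
have x0 : x != 0 by apply: contraNneq xy0 => ->; rewrite mul0r.
have y0 : y != 0 by apply: contraNneq xy0 => ->; rewrite mulr0.
have [[|n] [nx ex]] := nilpotency_order x0; first exact: ex.
have [m [ny ey]] := nilpotency_order y0.
have := iter_der_top ex ey; rewrite addSn iterSr dxy iter_der0 => /esym e.
have : (iter n.+1 d x * iter m d y) *+ 'C((n + m).+1, n.+1).-1.+1 = 0.
  by rewrite prednK // bin_gt0 ltnS leq_addr.
by move/(char0_torsion char0)/eqP; apply: contraTeq => _; apply: dom_mul_neq0.
Qed.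

Lemma unit_der0 (x : B) : is_unit x -> d x = 0.
Proof.
case=> y xy; apply: (@ker_factorially_closed x y); rewrite xy ?oner_neq0 //.
exact: der1.
Qed.

Lemma local_slice_exists : (exists b, d b != 0) -> exists s, d s != 0 /\ d (d s) = 0.
Proof.
case=> b db; have [n [nz z]] := nilpotency_order db.
exists (iter n d b); move: nz z.
by rewrite -[d (iter n d b)]iterS iterS -!iterSr.
Qed.

Definition slice (s : B) : Prop := d s = 1.

Section Slice.
Variables (s : B) (ds : slice s).

Local Notation A := (derker d).
Local Notation ev p := ((map_poly (derker_incl d) p).[s]).

Lemma der_slice (p : {poly A}) : d (ev p) = ev p^`().
Proof. by rewrite der_horner ?ds ?mulr1 // => a; apply: derker_inclE. Qed.

Lemma slice_inj (p : {poly A}) : ev p = 0 -> p = 0.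
Proof.
elim: {p}(size p) {-2}p (leqnn (size p)) => [|n IH] p sp ep.
  by apply/eqP; rewrite -size_poly_eq0 -leqn0.
have [->//|p0] := eqVneq p 0.
have dp : p^`() = 0.
  apply: IH; last by rewrite -der_slice ep raddf0.
  by rewrite -ltnS (leq_trans _ sp) // lt_size_deriv.
have ep0 : p = (p`_0)%:P.
  by apply: deriv_eq0_const => // m a; apply: (char0_torsion char0).
move: ep; rewrite ep0 map_polyC hornerC /= => e.
by rewrite (derker_incl_inj (e : _ = derker_incl d 0)) polyC0.
Qed.

(** Integration: the derivative of b, of smaller nilpotency order, is a
    polynomial in s, and b minus an antiderivative of it is a constant. *)
Lemma slice_surj (b : B) : exists p : {poly A}, b = ev p.
Proof.
have [n] := lnd b; elim: n b => [|n IH] b e.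
  by exists 0; rewrite rmorph0 horner0.
have [|q eq] := IH (d b); first by rewrite -iterSr.
have [p dp] := antiderivative char0 q.
have [a ea] : exists a, derker_incl d a = b - ev p.
  by apply: derkerP; rewrite raddfB /= der_slice dp eq subrr.
exists (p + a%:P); rewrite rmorphD hornerD /= map_polyC hornerC /=.
by rewrite ea addrC subrK.
Qed.

Lemma slice_trivial : trivial_A1_bundle (derker_incl d).
Proof.
pose g : {rmorphism {poly A} -> B} :=
  horner_morph (fun a => mulrC s (derker_incl d a)).
exists g; split=> [a|]; first by rewrite /g /= /horner_morph map_polyC hornerC.
apply: inj_surj_bij => [p q e|b]; last exact: slice_surj.
apply/eqP; rewrite -subr_eq0; apply/eqP/slice_inj.
by rewrite rmorphB hornerD hornerN [X in X - _]e subrr.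
Qed.

End Slice.

(** By the chain rule the derivative of the coordinate of the bundle divides all
    derivatives, so it is a unit of B; units are constants. *)
Lemma trivial_slice : irreducible_der d ->
  trivial_A1_bundle (derker_incl d) -> exists s, slice s.
Proof.
move=> irr [g [gC [h gh hg]]].
have gE p : g p = (map_poly (derker_incl d) p).[g 'X].
  elim/poly_ind: p => [|p c IH]; first by rewrite !rmorph0 horner0.
  by rewrite rmorphD rmorphM /= IH gC rmorphD rmorphM /= map_polyX map_polyC !hornerE.
have [c dc] : is_unit (d (g 'X)).
  apply: irr => b; exists (g (h b)^`()); rewrite -{1}[b]hg.
  rewrite (gE (h b)) (gE (h b)^`()) mulrC.
  by apply: der_horner => a; apply: derker_inclE.
exists (c * g 'X); rewrite /slice der_constM; first by rewrite mulrC.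
by apply: unit_der0; exists (d (g 'X)); rewrite mulrC.
Qed.

End Lnd.
End DerivationFacts.

(** * Prime elements of a factorial ring and of its constants *)

Section Factorial.
Variable R : comNzRingType.
Implicit Types x y z w : R.

Lemma divides_mulr x y z : divides x y -> divides x (y * z).
Proof. by case=> w ->; exists (w * z); rewrite mulrA. Qed.

Lemma divides_mull x y z : divides x z -> divides x (y * z).
Proof. by rewrite mulrC; apply: divides_mulr. Qed.

Lemma divides_trans x y z : divides x y -> divides y z -> divides x z.
Proof. by move=> xy [w ->]; apply: divides_mulr. Qed.

Lemma divides_prod (s : seq R) x : x \in s -> divides x (\prod_(y <- s) y).
Proof.
elim: s => //= y s IH; rewrite inE big_cons => /orP[/eqP->|/IH].
  by exists (\prod_(z <- s) z).
exact: divides_mull.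
Qed.

Lemma prime_divides_prod x (s : seq R) : prime_elt x ->
  divides x (\prod_(y <- s) y) -> exists2 y, y \in s & divides x y.
Proof.
move=> px; have [_ xu xp] := px; elim: s => [|y s IH]; rewrite ?big_nil ?big_cons.
  by case=> z e; case: xu; exists z.
case/xp => [xy|/IH[z zs xz]]; first by exists y; rewrite ?mem_head.
by exists z; rewrite // inE zs orbT.
Qed.

(** If x divides y z, by uniqueness x is associated to an irreducible factor of
    y or z; zeros and units, which need not be products of irreducibles, are set
    apart. *)
Lemma irreducible_prime x : factorial_ring R -> irreducible_elt x -> prime_elt x.
Proof.
case=> hR fact uniq irr; have [x0 xu xirr] := irr.
split=> // y z [w e].
have [->|y0] := eqVneq y 0; first by left; exists 0; rewrite mulr0.
have [->|z0] := eqVneq z 0; first by right; exists 0; rewrite mulr0.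
have [[y' yy']|yu] := pselect (is_unit y).
  by right; exists (w * y'); rewrite mulrA -e mulrAC yy' mul1r.
have [[z' zz']|zu] := pselect (is_unit z).
  by left; exists (w * z'); rewrite mulrA -e -mulrA zz' mulr1.
have [[s [sirr es]] [t [tirr et]]] := (fact y y0 yu, fact z z0 zu).
have st : factorization (s ++ t) (y * z).
  split; last by rewrite big_cat /= -es -et.
  by move=> a; rewrite mem_cat => /orP[/sirr|/tirr].
have w0 : w != 0.
  by apply: contraNneq (dom_mul_neq0 hR y0 z0) => w0; rewrite e w0 mulr0.
have [u [x' [fu x'u xx']]] : exists u x',
    [/\ factorization u (y * z), x' \in u & divides x x'].
  have [[w' ww']|wu] := pselect (is_unit w).
    exists [:: x * w], (x * w); split; rewrite ?mem_head //; last by exists w.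
    split; last by rewrite big_seq1.
    move=> a; rewrite inE => /eqP->; split; first exact: dom_mul_neq0.
      by case=> b eb; case: xu; exists (w * b); rewrite mulrA.
    move=> b c ebc; have [|[b' bb']|[c' cc']] := xirr b (c * w').
    - by rewrite mulrA -ebc -mulrA ww' mulr1.
    - by left; exists b'.
    - by right; exists (w' * c'); rewrite mulrA.
  have [u [uirr eu]] := fact w w0 wu; exists (x :: u), x.
  split; rewrite ?mem_head //; last by exists 1; rewrite mulr1.
  split; last by rewrite big_cons e eu.
  by move=> a; rewrite inE => /orP[/eqP->|/uirr].
have [t' [pt' sz /(_ (index x' u))]] := uniq _ _ _ fu st.
rewrite index_mem nth_index // => /(_ x'u)[v _ et'].
have : t'`_(index x' u) \in s ++ t.
  by rewrite -(perm_mem pt') mem_nth // -sz index_mem.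
rewrite et' mem_cat => /orP[/divides_prod|/divides_prod] h; [left|right];
  by rewrite ?es ?et; apply: divides_trans h; apply: divides_mull.
Qed.

End Factorial.

Section DerkerPrimes.
Variables (k : fieldType) (B : comAlgType k) (d : derivation B).
Hypothesis hB : GRing.integral_domain_axiom B.

(** The cofactor of a constant in a constant is a constant, by Leibniz. *)
Lemma divides_derker (f a : derker d) : f != 0 ->
  divides (derker_incl d f) (derker_incl d a) -> divides f a.
Proof.
move=> f0 [b eb]; have [c ec] : exists c, derker_incl d c = b.
  apply: derkerP; apply: (dom_mulfI hB (_ : derker_incl d f != 0)).
    by rewrite -(inj_eq (@derker_incl_inj _ _ d)) rmorph0 in f0.
  by rewrite mulr0 -der_constM ?derker_inclE // -eb derker_inclE.
by exists c; apply: derker_incl_inj; rewrite rmorphM /= ec.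
Qed.

Lemma derker_prime (f : derker d) : prime_elt (derker_incl d f) -> prime_elt f.
Proof.
case=> f0 fu fp.
have f0' : f != 0 by apply: contraNneq f0 => ->; rewrite rmorph0.
split=> // [[g fg]|y z].
  by apply: fu; exists (derker_incl d g); rewrite -rmorphM fg rmorph1.
case=> w e; have [|h|h] := fp (derker_incl d y) (derker_incl d z).
- by exists (derker_incl d w); rewrite -!rmorphM e.
- by left; apply: divides_derker.
- by right; apply: divides_derker.
Qed.

(** Factor b in B: the factors lie in A, which is factorially closed, and
    irreducible elements of B are prime. *)
Lemma derker_factorization (b : B) : (forall n, n.+1%:R != 0 :> k) ->
  locally_nilpotent d -> factorial_ring B -> b != 0 -> d b = 0 ->
  is_unit b \/ exists s : seq (derker d),
    (forall f, f \in s -> prime_elt (derker_incl d f)) /\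
    b = derker_incl d (\prod_(f <- s) f).
Proof.
move=> char0 lnd ufd b0 db; have [|bu] := pselect (is_unit b); [by left|right].
have [_ /(_ b b0 bu)[s [sirr eb]] _] := ufd; move: b0 db; rewrite eb {b bu eb}.
elim: s sirr => [|x s IH] sirr.
  by exists [::]; split; rewrite // !big_nil rmorph1.
rewrite big_cons => xs0 dxs.
have dx := ker_factorially_closed char0 hB lnd xs0 dxs.
rewrite mulrC in xs0 dxs.
have ds := ker_factorially_closed char0 hB lnd xs0 dxs.
have [||t [tp et]] := IH _ _ ds.
- by move=> y ys; apply: sirr; rewrite inE ys orbT.
- by apply: contraNneq xs0 => ->; rewrite mul0r.
have [f ef] := derkerP dx; exists (f :: t); split.
  move=> g; rewrite inE => /orP[/eqP->|/tp//]; rewrite ef.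
  by apply: irreducible_prime => //; apply: sirr; rewrite mem_head.
by rewrite !big_cons rmorphM /= ef et.
Qed.

End DerkerPrimes.

Section ConstantPrimes.
Variables (k : fieldType) (B : comAlgType k) (d : derivation B).
Hypotheses (char0 : forall n, n.+1%:R != 0 :> k)
  (hB : GRing.integral_domain_axiom B) (lnd : locally_nilpotent d)
  (ufd : factorial_ring B).

Lemma derker_unit (f : derker d) : is_unit (derker_incl d f) -> is_unit f.
Proof. by move=> uf; apply: contrapT => /derker_nonunit. Qed.

Lemma derker_prime_factors (a : derker d) : a != 0 -> ~ is_unit a ->
  exists s : seq (derker d),
    (forall f, f \in s -> prime_elt (derker_incl d f)) /\ a = \prod_(f <- s) f.
Proof.
move=> a0 au; have a0' : derker_incl d a != 0.
  by rewrite -(rmorph0 (derker_incl d)) (inj_eq (@derker_incl_inj _ _ d)).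
have [/derker_unit//|[s [sp e]]] :=
  derker_factorization hB char0 lnd ufd a0' (derker_inclE a).
by exists s; split=> //; apply: derker_incl_inj.
Qed.

(** A prime of A divides one of its own factors that are prime in B, hence is
    associated to it. *)
Lemma prime_derker (f : derker d) : prime_elt f -> prime_elt (derker_incl d f).
Proof.
move=> fp; have [f0 fu _] := fp.
have [s [sp e]] := derker_prime_factors f0 fu.
have [|g gs [c gc]] := prime_divides_prod (s := s) fp.
  by exists 1; rewrite mulr1 e.
have [w fw] : divides g f by rewrite e; apply: divides_prod.
have cw : c * w = 1.
  have hA := sub_domain hB (phi := derker_incl d) (@derker_incl_inj _ _ d).
  by apply: (dom_mulfI hA f0); rewrite mulr1 mulrA -gc.
have [g0 gu gmul] := sp g gs; split.
- by rewrite -(rmorph0 (derker_incl d)) (inj_eq (@derker_incl_inj _ _ d)).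
- by apply: derker_nonunit.
move=> y z [v e']; have fg x : divides (derker_incl d g) x -> divides (derker_incl d f) x.
  case=> t ->; exists (derker_incl d c * t).
  by rewrite mulrA -rmorphM -gc.
case: (gmul y z) => [|/fg|/fg]; [|by left|by right].
by exists (derker_incl d w * v); rewrite mulrA -rmorphM -fw.
Qed.

End ConstantPrimes.

(** * Contraction of ideals along a faithfully flat morphism *)

Section FaithfulFlatness.
Variables (A B : comNzRingType) (phi : {rmorphism A -> B}).

Lemma balanced0 (M N : lmodType A) (P : zmodType) (b : M -> N -> P) n :
  balanced b -> b 0 n = 0.
Proof.
by case=> _ bD _; apply: (addrI (b 0 n)); rewrite -bD !addr0.
Qed.

Lemma balanced_sum (M N : lmodType A) (P : zmodType) (b : M -> N -> P) m
    k (F : 'I_k -> N) :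
  balanced b -> b m (\sum_(i < k) F i) = \sum_(i < k) b m (F i).
Proof.
case=> bD _ _; apply: (big_morph (b m)) => //.
by apply: (addrI (b m 0)); rewrite -bD !addr0.
Qed.

(** If h lay in the extension of I but not in I, multiplication by h would embed
    A/(I : h) into A/I; after tensoring with B it kills 1, yet B/(I : h)B is
    nonzero since some prime of B lies over a maximal ideal containing (I : h). *)
Lemma faithfully_flat_contraction (I : idealr A) (h : A) :
  faithfully_flat phi -> extended_ideal phi I (phi h) -> h \in I.
Proof.
case=> flat surj [n [a [c [aI eh]]]]; apply/negPn/negP => hI.
have [|||J hJ] := @idealr_of A (fun x => x * h \in I).
- by rewrite mul0r rpred0.
- by rewrite mul1r; apply/negP.
- by move=> x y z xI yI; rewrite mulrDl -mulrA rpredD // idealMr.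
have [m max Jm] := maximal_exists J; have [p pm] := maximal_prime max.
have [q qp] := surj p.
pose piJ : {rmorphism A -> {ideal_quot J}} := \pi_{ideal_quot J}.
pose piI : {rmorphism A -> {ideal_quot I}} := \pi_{ideal_quot I}.
pose piq : {rmorphism B -> {ideal_quot q}} := \pi_{ideal_quot q}.
pose M := restrict_scalars piJ; pose M' := restrict_scalars piI.
pose N := restrict_scalars phi.
pose uf (y : M) : M' := piI (repr (y : {ideal_quot J}) * h).
have reprJ x : repr (piJ x) - x \in J by rewrite Quotient.idealrBE reprK.
have ufE x : uf (piJ x) = piI (x * h).
  apply/eqP; rewrite -subr_eq0 -[_ - _](rmorphB piI) -mulrBl quot_pi_eq0.
  exact/hJ.
have uf_linear : linear uf.
  move=> x y z; have [[y' ->] [z' ->]] := (quot_pi_surj y, quot_pi_surj z).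
  rewrite !ufE.
  rewrite (_ : x *: (\pi y' : M) + \pi z' = piJ (x * y' + z')).
    by rewrite ufE mulrDl rmorphD -mulrA rmorphM.
  by rewrite rmorphD rmorphM.
pose um := GRing.isLinear.Build A M M' _ uf uf_linear.
pose u : {linear M -> M'} := HB.pack uf um.
have u_inj : injective u.
  move=> y z; have [[y' ->] [z' ->]] := (quot_pi_surj y, quot_pi_surj z).
  rewrite /= !ufE => e; apply/eqP.
  rewrite -subr_eq0 -[_ - _](rmorphB piJ) quot_pi_eq0; apply/hJ.
  by rewrite mulrBl -(quot_pi_eq0 I) rmorphB subr_eq0; apply/eqP.
(* 1 (x) 1 and 0 have the same image in A/I (x) B, hence are equal *)
have := flat M M' u u_inj (\pi_(tensor M N) [:: (1, 1)]) (\pi_(tensor M N) [::]).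
rewrite !tensor_mapE /= => ht.
have : \pi_(tensor M N) [:: (1 : M, 1 : N)] = \pi_(tensor M N) [::].
  apply: ht; apply/eqP; rewrite eqquotE; apply/asboolP => P b bal.
  rewrite big_seq1 big_nil /=; have [_ _ bZ] := bal.
  have -> : uf 1 = h *: (1 : M').
    by rewrite -(rmorph1 piJ) ufE mul1r /GRing.scale /= /restrict_scale mulr1.
  rewrite bZ; have -> : h *: (1 : N) = \sum_(i < n) a i *: (c i : N).
    by rewrite {1}/GRing.scale /= /restrict_scale mulr1 eh.
  rewrite balanced_sum // big1 // => i _; rewrite -bZ.
  have -> : a i *: (1 : M') = 0.
    apply/eqP; rewrite /GRing.scale /= /restrict_scale mulr1.
    by rewrite quot_pi_eq0.
  exact: (balanced0 (c i : N) bal).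
move/eqP; rewrite eqquotE => /asboolP.
(* but the balanced map (y, x) |-> y x from A/J and B to B/q separates them *)
pose b (y : M) (x : N) : {ideal_quot q} :=
  piq (phi (repr (y : {ideal_quot J})) * (x : B)).
have bE x z : b (piJ x) z = piq (phi x * (z : B)).
  apply/eqP; rewrite -subr_eq0 -[_ - _](rmorphB piq) -mulrBl -rmorphB quot_pi_eq0.
  by rewrite mulrC idealMr // -qp pm Jm.
move/(_ _ b); rewrite big_seq1 big_nil /=.
have -> : b 1 1 = 1 by rewrite -(rmorph1 piJ) bE rmorph1 mul1r rmorph1.
suff bal : balanced b by move=> /(_ bal)/eqP; rewrite oner_eq0.
split=> [y z z'|z y y'|x y z].
- have [y' ->] := quot_pi_surj y.
  by rewrite !bE mulrDr rmorphD.
- have [[x ->] [x' ->]] := (quot_pi_surj y, quot_pi_surj y').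
  by rewrite -[_ + _](rmorphD piJ) !bE rmorphD mulrDl rmorphD.
- have [y' ->] := quot_pi_surj y.
  rewrite (_ : x *: (\pi y' : M) = piJ (x * y')); last by rewrite rmorphM.
  rewrite !bE /GRing.scale /= /restrict_scale (rmorphM phi); congr (piq _).
  by rewrite [RHS]mulrCA mulrA.
Qed.

Lemma faithfully_flat_contraction2 (b f h : A) (x y : B) :
  faithfully_flat phi -> phi h = phi b * x + phi f * y ->
  exists c1 c2, h = b * c1 + f * c2.
Proof.
move=> ff e; apply: contrapT => nh.
have [|||I hI] := @idealr_of A (fun z => exists c1 c2, z = b * c1 + f * c2).
- by exists 0, 0; rewrite !mulr0 addr0.
- case=> c1 [c2 e1]; apply: nh; exists (h * c1), (h * c2).
  by rewrite mulrCA [f * _]mulrCA -mulrDr -e1 mulr1.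
- move=> z _ _ [c1 [c2 ->]] [c1' [c2' ->]]; exists (z * c1 + c1'), (z * c2 + c2').
  by rewrite !mulrDr addrACA [b * (z * _)]mulrCA [f * (z * _)]mulrCA.
apply: nh; apply/hI/faithfully_flat_contraction => //.
exists 2, (fun i : 'I_2 => if val i == 0%N then b else f),
  (fun i : 'I_2 => if val i == 0%N then x else y).
split=> [i|]; last by rewrite !big_ord_recl big_ord0 /= addr0.
case: ifP => _; apply/hI.
  by exists 1, 0; rewrite mulr1 mulr0 addr0.
by exists 0, 1; rewrite mulr1 mulr0 add0r.
Qed.

End FaithfulFlatness.

(** * Affine lines as fibres *)

Section Fibres.
Variables (k : fieldType) (B : comAlgType k) (d : derivation B).
Hypothesis char0 : forall n, n.+1%:R != 0 :> k.

(** On an affine line a derivation is a multiple of d/dt; unless it is zero,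
    only scalars are constant. *)
Lemma A1_quotient_constants (I : idealr B)
    (g : {lrmorphism {ideal_quot I} -> {poly k}}) (b x : B) :
  bijective g -> (forall y, y \in I -> d y \in I) ->
  d b \notin I -> d x \in I -> exists r : k, x - r%:A \in I.
Proof.
move=> [g' gK g'K] dI db dx; pose Q := {ideal_quot I}.
pose G y := g (\pi_Q y).
have GI y : (G y == 0) = (y \in I).
  by rewrite -quot_pi_eq0 -(rmorph0 g) (can_eq gK).
have GB y z : G (y - z) = G y - G z by rewrite /G !rmorphB.
have GD y z : G (y + z) = G y + G z by rewrite /G !rmorphD.
have GM y z : G (y * z) = G y * G z by rewrite /G !rmorphM.
have Gk c : G c%:A = c%:P by rewrite /G quot_piZ linearZ /= !rmorph1 alg_polyC.
have [t et] := quot_pi_surj (g' 'X).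
have Gt : G t = 'X by rewrite /G -et g'K.
pose ev (p : {poly k}) := (map_poly (in_alg B) p).[t].
have Gev p : G (ev p) = p.
  rewrite /ev; elim/poly_ind: p => [|p c IH].
    by rewrite rmorph0 horner0; apply/eqP; rewrite GI rpred0.
  rewrite rmorphD rmorphM /= map_polyX map_polyC !hornerE.
  by rewrite GD GM IH Gt Gk.
have Gd y : G (d y) = (G y)^`() * G (d t).
  rewrite -[in RHS](Gev (G y)^`()) -GM /ev -(der_horner (phi := in_alg B)); last first.
    exact: der_scalar.
  apply/eqP; rewrite -subr_eq0 -GB GI -raddfB; apply: dI.
  by rewrite -GI GB Gev subrr.
have dt : G (d t) != 0.
  by apply: contraNneq db => dt0; rewrite -GI Gd dt0 mulr0.
have : G (d x) == 0 by rewrite GI.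
rewrite Gd mulf_eq0 (negbTE dt) orbF => /eqP dGx.
exists (G x)`_0; rewrite -GI GB Gk -deriv_eq0_const ?subrr //.
by move=> n a; apply: (@char0_torsion k char0 k^o).
Qed.

Lemma extended_ideal_stable (I : idealr (derker d)) (y : B) :
  extended_ideal (derker_incl d) I y -> extended_ideal (derker_incl d) I (d y).
Proof.
case=> n [a [c [aI ->]]]; exists n, a, (fun i => d (c i)); split=> //.
rewrite raddf_sum; apply: eq_bigr => i _.
by rewrite /= der_constM // derker_inclE.
Qed.

Lemma extended_ideal_mull (A : comNzRingType) (phi : {rmorphism A -> B})
    (I : idealr A) (a : A) (y : B) :
  a \in I -> extended_ideal phi I (phi a * y).
Proof.
by exists 1%N, (fun _ => a), (fun _ => y); split; rewrite // big_ord1.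
Qed.

Lemma extended_ideal_vanish (A : comNzRingType) (phi : {rmorphism A -> B})
    (S : comNzRingType) (h : {rmorphism B -> S}) (I : idealr A) (y : B) :
  (forall a, a \in I -> h (phi a) = 0) -> extended_ideal phi I y -> h y = 0.
Proof.
move=> h0 [n [a [c [aI ->]]]]; rewrite rmorph_sum big1 // => i _.
by rewrite rmorphM h0 // mul0r.
Qed.

Lemma kernel_maximal (A : comAlgType k) (chi : {rmorphism A -> k}) :
  (forall c, chi c%:A = c) ->
  exists2 m : idealr A, maximal_idealr m & forall a, a \in m <-> chi a = 0.
Proof.
move=> chik; have [|||m hm] := @idealr_of A (fun a => chi a = 0).
- exact: rmorph0.
- by rewrite rmorph1 => /eqP; rewrite oner_eq0.
- by move=> a x y ex ey; rewrite rmorphD rmorphM ex ey mulr0 addr0.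
exists m => // J mJ a aJ; apply/hm/eqP/negPn/negP => ca.
have h : (chi a)^-1%:A * a - 1 \in J.
  by apply/mJ/hm; rewrite rmorphB rmorphM chik mulVf ?rmorph1 ?subrr.
have : (chi a)^-1%:A * a - ((chi a)^-1%:A * a - 1) \in J.
  by rewrite rpredB // idealMr.
by rewrite subKr idealr1.
Qed.

End Fibres.

(** * Reduction modulo a prime constant *)

Section ModuloConstantPrime.
Variables (k : closedFieldType) (B : comAlgType k) (d : derivation B).
Variables (f : derker d) (hf : ~ is_unit f).
Hypotheses (char0 : forall n, n.+1%:R != 0 :> k)
  (hB : GRing.integral_domain_axiom B) (fprime : prime_elt (derker_incl d f)).

Local Notation QA := {ideal_quot (idealA hf)}.
Local Notation QB := {ideal_quot (idealB hf)}.

Lemma idealAE a : (a \in idealA hf) <-> divides f a.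
Proof. by split=> /asboolP. Qed.

Lemma idealBE b : (b \in idealB hf) <-> divides (derker_incl d f) b.
Proof. by split=> /asboolP. Qed.

Lemma derker_f_neq0 : f != 0.
Proof. by case: (derker_prime hB fprime). Qed.

Lemma idealAB a : (derker_incl d a \in idealB hf) = (a \in idealA hf).
Proof.
apply/idP/idP => [/idealBE h|/idealAE[b ->]]; last first.
  by apply/idealBE; exists (derker_incl d b); rewrite rmorphM.
by apply/idealAE/(divides_derker hB derker_f_neq0).
Qed.

Lemma idealB_prime x y :
  x * y \in idealB hf -> x \in idealB hf \/ y \in idealB hf.
Proof.
have [_ _ fp] := fprime.
by move=> /idealBE/fp[]/idealBE; [left|right].
Qed.

Lemma quotB_domain : GRing.integral_domain_axiom QB.
Proof.
move=> x y; have [[a ->] [b ->]] := (quot_pi_surj x, quot_pi_surj y).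
rewrite -rmorphM => /eqP; rewrite !quot_pi_eq0.
by move=> /idealB_prime[]->; rewrite ?orbT.
Qed.

(** The inclusion of A/fA in B/fB. *)
Definition quot_incl : {rmorphism QA -> QB} :=
  (val : derker (induced_der hf) -> QB) \o tau hf.

Lemma quot_inclE a : quot_incl (\pi_QA a) = \pi_QB (derker_incl d a).
Proof. exact: tau_funE. Qed.

Lemma quot_incl_inj : injective quot_incl.
Proof.
move=> x y; have [[a ->] [b ->]] := (quot_pi_surj x, quot_pi_surj y).
move=> e; apply/eqP; rewrite -subr_eq0 -rmorphB quot_pi_eq0 -idealAB.
by rewrite -quot_pi_eq0 -quot_inclE (rmorphB \pi_QA) (rmorphB quot_incl) e subrr.
Qed.

(** If x is not a fraction modulo f, there are two morphisms B/fB -> k that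
    agree on A/fA, differ at x and kill neither alpha nor d b. So x is not a
    scalar on the fibre over their common closed point of A, although that fibre
    is an affine line on which d induces a nonzero derivation annihilating x. *)
Lemma generic_fibre_fraction (alpha : derker d) (b x : B) :
  finitely_generated (derker d) -> finitely_generated B ->
  (forall m : idealr (derker d), maximal_idealr m ->
     alpha \notin m -> fiber_is_A1 (derker_incl d : {lrmorphism derker d -> B}) m) ->
  ~ divides f alpha -> ~ divides (derker_incl d f) (d b) ->
  divides (derker_incl d f) (d x) ->
  exists c h : derker d, ~ divides f c /\
    divides (derker_incl d f) (derker_incl d c * x - derker_incl d h).
Proof.
move=> /finitely_generated_ring[sA genA] /finitely_generated_ring[sB genB].
move=> fib falpha fdb fdx; apply: contrapT => nfrac.
pose piA : {rmorphism derker d -> QA} := \pi_QA.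
pose piB : {rmorphism B -> QB} := \pi_QB.
pose v := piB (derker_incl d alpha * d b).
have v0 : v != 0.
  rewrite quot_pi_eq0; apply/negP => /idealB_prime[]; last by move/idealBE.
  by rewrite idealAB => /idealAE.
pose T1 := adjoin quot_incl (piB x).
have hT1 : GRing.integral_domain_axiom T1 := adjoin_domain quotB_domain.
have [|||u1 u10 ext1] := @extend_generated k QB quotB_domain (map piB sB) T1 val v.
- exact: val_inj.
- apply: genB => [y|c]; first exact: quot_pi_surj.
  exists (adjoin_base quot_incl (piB x) (piA c%:A)).
  by rewrite -[LHS]/(quot_incl (piA c%:A)) quot_inclE linearZ /= rmorph1.
- exact: v0.
have hQA := sub_domain quotB_domain quot_incl_inj.
have base_inj := adjoin_base_inj (x := piB x) quot_incl_inj.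
have [|||u u0 ext] := extend_step_avoiding hT1 base_inj
  (@adjoin_generated _ _ quot_incl (piB x)) k (v := u1).
- move=> n; apply: contra_neq (oner_neq0 QA); exact: char0_torsion.
- move=> c h c0 /(congr1 val) e; apply: nfrac.
  have [[c' ec] [h' eh]] := (quot_pi_surj c, quot_pi_surj h); exists c', h'.
  split; first by move=> /idealAE; rewrite -quot_pi_eq0 -ec; apply/negP.
  have {}e : quot_incl c * piB x = quot_incl h by exact: e.
  move: e; rewrite ec eh !quot_inclE => /eqP; rewrite -subr_eq0 => e.
  by apply/idealBE; rewrite -quot_pi_eq0 rmorphB rmorphM.
- exact: u10.
have [|||w w0 ext0] := @extend_generated k QA hQA (map piA sA) k (piA \o in_alg _) u.
- exact: fmorph_inj.
- by apply: genA => [y|c]; [exact: quot_pi_surj | exists c].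
- exact: u0.
(* chi0 is the closed point of A/fA, and X1, X2 are the two points above it *)
have [//|chi0 chik chiu] := ext0 idfun.
have [chi1 [e1 n1 _]] := ext chi0 0 chiu; have [X1 E1 N1] := ext1 chi1 n1.
have [chi2 [e2 n2 ne]] := ext chi0 (X1 (piB x)) chiu.
have [X2 E2 N2] := ext1 chi2 n2.
have X1A a : X1 (piB (derker_incl d a)) = chi0 (piA a).
  by rewrite -e1 -E1; congr (X1 _); apply/esym/quot_inclE.
have X2A a : X2 (piB (derker_incl d a)) = chi0 (piA a).
  by rewrite -e2 -E2; congr (X2 _); apply/esym/quot_inclE.
have X2x : X2 (piB x) = chi2 (adjoin_gen quot_incl (piB x)) by rewrite -E2.
have [m max hm] := @kernel_maximal k (derker d) (chi0 \o piA) chik.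
have [|I hI [g gbij]] := fib m max.
  apply/negP => /hm /= ca; case/eqP: N1.
  by rewrite /v !rmorphM X1A ca mul0r.
have XI (X : {rmorphism QB -> k}) :
    (forall a, X (piB (derker_incl d a)) = chi0 (piA a)) ->
    forall y, y \in I -> X (piB y) = 0.
  move=> XA y /hI; apply: (extended_ideal_vanish (h := X \o piB)) => a /hm.
  by rewrite /= XA.
have fI y : divides (derker_incl d f) y -> y \in I.
  case=> z ->; apply/hI/extended_ideal_mull/hm => /=.
  rewrite (_ : piA f = 0) ?rmorph0 //; apply/eqP; rewrite quot_pi_eq0.
  by apply/idealAE; exists 1; rewrite mulr1.
have [|||r hr] := @A1_quotient_constants k B d char0 I g b x gbij.
- by move=> y /hI h; apply/hI/extended_ideal_stable.
- apply/negP => /(XI _ X1A) e; case/eqP: N1.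
  by rewrite /v !rmorphM e mulr0.
- exact: fI.
have Xr (X : {rmorphism QB -> k}) :
    (forall a, X (piB (derker_incl d a)) = chi0 (piA a)) ->
    X (piB x) = r.
  move=> XA; have := XI _ XA _ hr; rewrite !rmorphB => /eqP; rewrite subr_eq0.
  have -> : r%:A = derker_incl d r%:A by rewrite linearZ /= rmorph1.
  by rewrite XA => /eqP ->; apply: chik.
by case/eqP: ne; rewrite -X2x !Xr.
Qed.

End ModuloConstantPrime.

(** * Fraction fields and birational morphisms *)

Lemma fraction_numden (R : idomainType) (y : {fraction R}) :
  exists n m : R, m != 0 /\ y * tofrac m = tofrac n.
Proof.
elim/quotW: y => x; exists (frac x).1, (frac x).2; split; first exact: denom_ratioP.
unlock tofrac FracField.tofrac; rewrite -[LHS]FracField.pi_mul.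
apply/eqmodP => /=; rewrite FracField.equivfE /FracField.mulf.
by rewrite !numden_Ratio ?oner_neq0 ?mulr1 ?denom_ratioP // mulrC.
Qed.
Lemma fraction_morph (R S : idomainType) (phi : {rmorphism R -> S}) :
  injective phi -> exists g : {rmorphism {fraction R} -> {fraction S}},
    forall x, g (tofrac x) = tofrac (phi x).
Proof.
move=> phi_inj; have phi0 (m : R) : m != 0 -> tofrac (phi m) != 0.
  by move=> m0; rewrite tofrac_eq0 -(rmorph0 phi) (inj_eq phi_inj).
pose num (y : {fraction R}) := projT1 (cid (fraction_numden y)).
pose den (y : {fraction R}) := projT1 (cid (projT2 (cid (fraction_numden y)))).
have numden (y : {fraction R}) : den y != 0 /\ y * tofrac (den y) = tofrac (num y).
  by rewrite /den /num; case: cid => n /= e; case: cid.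
pose f (y : {fraction R}) := tofrac (phi (num y)) / tofrac (phi (den y)).
have fE (y : {fraction R}) (n m : R) : m != 0 -> y * tofrac m = tofrac n ->
    f y = tofrac (phi n) / tofrac (phi m).
  move=> m0 e; have [d0 e'] := numden y.
  apply/eqP; rewrite /f eqr_div ?phi0 // -!tofracM -!rmorphM tofrac_eq.
  rewrite (_ : num y * m = n * den y) //.
  by apply/eqP; rewrite -tofrac_eq !tofracM -e -e' mulrAC.
have fB : zmod_morphism f.
  move=> y z; have [[d0 e] [d0' e']] := (numden y, numden z).
  rewrite (fE (y - z) (num y * den z - num z * den y) (den y * den z)) ?mulf_neq0 //.
    rewrite /f -[in RHS]mulNr addf_div ?phi0 // rmorphB !rmorphM.
    by rewrite tofracB !tofracM mulNr.
  rewrite tofracB !tofracM -e -e' mulrBl mulrA; congr (_ - _).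
  by rewrite [tofrac (den y) * _]mulrC mulrA.
have fM : monoid_morphism f.
  split.
    by rewrite (fE 1 1 1) ?oner_neq0 ?mul1r // rmorph1 divff ?tofrac1 ?oner_neq0.
  move=> y z; have [[d0 e] [d0' e']] := (numden y, numden z).
  rewrite (fE (y * z) (num y * num z) (den y * den z)) ?mulf_neq0 //.
    by rewrite !rmorphM invfM mulrACA.
  by rewrite !tofracM -e -e' mulrACA.
pose am := GRing.isZmodMorphism.Build _ _ f fB.
pose mm := GRing.isMonoidMorphism.Build _ _ f fM.
pose g : {rmorphism {fraction R} -> {fraction S}} := HB.pack f am mm.
exists g => x; rewrite [LHS](fE _ x 1) ?oner_neq0 ?tofrac1 ?mulr1 //.
by rewrite rmorph1 tofrac1 divr1.
Qed.

Lemma bijective_birational (R S : comNzRingType) (phi : {rmorphism R -> S})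
    (hR : GRing.integral_domain_axiom R) (hS : GRing.integral_domain_axiom S) :
  injective phi -> (forall y, exists x, y = phi x) -> birational phi.
Proof.
move=> phi_inj phi_surj; exists hR, hS.
have [g gE] := @fraction_morph (domain_of hR) (domain_of hS) phi phi_inj.
exists g; split=> //; apply: inj_surj_bij => [|y]; first exact: fmorph_inj.
have [n [m [m0 e]]] := fraction_numden y.
have [[n' en] [m' em]] := (phi_surj n, phi_surj m).
have m'0 : tofrac (m' : domain_of hR) != 0.
  by rewrite tofrac_eq0; apply: contraNneq m0 => m'0; rewrite em m'0 rmorph0.
exists (tofrac (n' : domain_of hR) / tofrac (m' : domain_of hR)).
rewrite fmorph_div !gE -[phi n']en -[phi m']em -e mulfK //.
by rewrite tofrac_eq0.
Qed.

(** * From fibres to a slice *)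

Section SliceFromFibres.
Variables (k : closedFieldType) (B : comAlgType k) (d : derivation B).
Hypotheses (char0 : forall n, n.+1%:R != 0 :> k)
  (hB : GRing.integral_domain_axiom B).

Lemma birational_fraction (f : derker d) (hf : ~ is_unit f) (x : B) :
  birational (tau hf) -> divides (derker_incl d f) (d x) ->
  exists c h : derker d, ~ divides f c /\
    divides (derker_incl d f) (derker_incl d c * x - derker_incl d h).
Proof.
case=> hR [hS [g [gE [g' gK g'K]]]] /(@idealBE _ _ _ _ hf) dx.
pose piB : {rmorphism B -> {ideal_quot (idealB hf)}} := \pi_{ideal_quot (idealB hf)}.
have kx : piB x \in derker_pred (induced_der hf).
  by rewrite unfold_in [induced_der hf _]induced_funE quot_pi_eq0.
pose xi : derker (induced_der hf) := Derker kx.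
have [n [m [m0 e]]] := fraction_numden (g' (tofrac (xi : domain_of hS))).
have [[n' en] [m' em]] := (quot_pi_surj n, quot_pi_surj m).
exists m', n'; split.
  by move=> /(@idealAE _ _ _ _ hf); rewrite -quot_pi_eq0 -em; apply/negP.
have eg : tofrac (xi : domain_of hS) * tofrac (tau hf m : domain_of hS) =
          tofrac (tau hf n : domain_of hS).
  by rewrite -!gE -[tofrac (xi : domain_of hS)]g'K -rmorphM e.
have {eg} : xi * tau hf m = tau hf n.
  by move: eg; rewrite -tofracM => /eqP; rewrite tofrac_eq => /eqP.
move/(congr1 val) => e1.
have : piB x * quot_incl hf m = quot_incl hf n by exact: e1.
rewrite en em !quot_inclE => /eqP; rewrite -subr_eq0 mulrC => e2.
by apply/(@idealBE _ _ _ _ hf); rewrite -quot_pi_eq0 rmorphB rmorphM.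
Qed.

(** If f a is the derivative of s, then s is a constant modulo f up to a
    denominator c prime to f: c s = h + f t. By faithful flatness h lies in the
    ideal (c, f) of the constants, so that s itself is a constant modulo f, and
    dividing by f shows that a is a derivative. *)
Lemma plinth_divide (f a : derker d) (s : B) :
  faithfully_flat (derker_incl d) -> prime_elt (derker_incl d f) ->
  d s = derker_incl d (f * a) ->
  (exists c h : derker d, ~ divides f c /\
    divides (derker_incl d f) (derker_incl d c * s - derker_incl d h)) ->
  exists t, d t = derker_incl d a.
Proof.
move=> ff fp ds [c [h [fc [t et]]]]; have [f0 _ fmul] := fp.
have [|c1 [c2 e]] := @faithfully_flat_contraction2 _ _ _ c f h s (- t) ff.
  by rewrite mulrN -et subKr.
have e1 : derker_incl d c * (s - derker_incl d c1) =
          derker_incl d f * (t + derker_incl d c2).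
  by rewrite mulrBr mulrDr -et -!rmorphM e rmorphD opprD addrA subrK.
have [|fc'|[t' et']] := fmul (derker_incl d c) (s - derker_incl d c1).
- by exists (t + derker_incl d c2).
- by case: fc; apply: (divides_derker hB) => //; apply: derker_f_neq0 fp.
exists t'; apply: (dom_mulfI hB f0).
rewrite -der_constM ?derker_inclE // -et' raddfB /= derker_inclE subr0 ds.
by rewrite rmorphM.
Qed.

(** The derivative of a local slice is a unit or a product of primes of A, whose
    factors can be divided out one after the other. *)
Lemma slice_of_fractions :
  factorial_ring B -> locally_nilpotent d -> irreducible_der d ->
  faithfully_flat (derker_incl d) ->
  (forall (f : derker d) (x : B), prime_elt (derker_incl d f) ->
     divides (derker_incl d f) (d x) ->
     exists c h : derker d, ~ divides f c /\
       divides (derker_incl d f) (derker_incl d c * x - derker_incl d h)) ->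
  exists s, slice d s.
Proof.
move=> ufd lnd irr ff frac.
have [|s [ds dds]] := local_slice_exists lnd.
  apply: contrapT => nd; have [|u] := irr 0; last first.
    by rewrite mul0r => /esym/eqP; rewrite oner_eq0.
  move=> x; exists 0; rewrite mul0r; apply/eqP/negPn/negP => dx.
  by apply: nd; exists x.
have [[u eu]|[l [lp el]]] := derker_factorization hB char0 lnd ufd ds dds.
  exists (u * s); rewrite /slice der_constM 1?mulrC //.
  by apply: (unit_der0 char0 hB lnd); exists (d s); rewrite mulrC.
elim: l s {ds dds} lp el => [|f l IH] s lp.
  by rewrite big_nil rmorph1 => ds; exists s.
rewrite big_cons => ds; have fp := lp f (mem_head _ _).
have [|t dt] := plinth_divide ff fp ds.
  by apply: frac => //; exists (derker_incl d (\prod_(g <- l) g)); rewrite ds rmorphM.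
by apply: (IH t) => // g gl; apply: lp; rewrite inE gl orbT.
Qed.

End SliceFromFibres.

(** * Height one primes *)

Section PrimeHeight.
Variables (R : comNzRingType) (hR : GRing.integral_domain_axiom R).

Lemma zero_prime_ideal : exists z : prime_idealr R, forall x, (x \in z) = (x == 0).
Proof.
have [|||I hI] := @idealr_of R (fun x => x == 0).
- exact: eqxx.
- by rewrite oner_eq0.
- by move=> a x y /eqP-> /eqP->; rewrite mulr0 addr0.
have IE x : (x \in I) = (x == 0) by apply/idP/idP => /hI.
have [x y|z zI] := prime_idealr_of (I := I).
  by rewrite !IE => /eqP/hR/orP.
by exists z => x; rewrite zI IE.
Qed.

(** The height of (f) is one because a nonzero prime ideal inside (f) contains a
    prime element divisible by f, hence associated to f. *)
Lemma codim_prime (f : R) : prime_elt f ->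
  (forall a, a != 0 -> ~ is_unit a ->
     exists s : seq R, (forall g, g \in s -> prime_elt g) /\ a = \prod_(g <- s) g) ->
  codim_V f 1.
Proof.
move=> fp fact; have [f0 fu fmul] := fp; have [z zE] := zero_prime_ideal.
have height1 (q : prime_idealr R) : f \in q -> height_ge q 1.
  move=> fq; exists (fun i => if i is 0%N then z else q) => // -[|//] _ /=.
  split=> [x|zq]; first by rewrite zE => /eqP->; rewrite rpred0.
  by move: f0; rewrite -zE zq.
have fE x : (x \in principal fu) <-> divides f x by split=> /asboolP.
have [x y /fE/fmul[]/fE|q qE] := @prime_idealr_of R (principal fu); [by left|by right|].
have fq : f \in q by rewrite qE; apply/fE; exists 1; rewrite mulr1.
split=> //; exists q => //; split; first exact: height1.
case=> p chain p2q; have [[_ n01] [s12 n12]] := (chain 0 isT, chain 1 isT).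
case: n12 => y; rewrite p2q qE => /fE[w ->].
suff fp1 : f \in p 1%N by rewrite mulrC; apply: idealMr.
have [a ap1 a0] : exists2 a, a \in p 1%N & a != 0.
  apply: contrapT => na; apply: n01 => a ap1; have [->|a0] := eqVneq a 0.
    by rewrite rpred0.
  by case: na; exists a.
have [|l [lp ea]] := fact a a0.
  by case=> b ab; move: (idealMr b ap1); rewrite mulrC ab idealr1.
have [g gl gp1] : exists2 g, g \in l & g \in p 1%N.
  move: ap1; rewrite ea; elim: (l) => [|g l' IH]; first by rewrite big_nil idealr1.
  rewrite big_cons prime_idealrM => /orP[gp|/IH[g' g'l g'p]].
    by exists g; rewrite ?mem_head.
  by exists g'; rewrite // inE g'l orbT.
have [g0 gu gmul] := lp g gl.
have /fE[c gc] : g \in principal fu by rewrite -qE -p2q s12.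
have [|[e fe]|[e ce]] := gmul f c; first by exists 1; rewrite mulr1 gc.
  by rewrite fe mulrC idealMr.
case: (fu); exists e; apply: (dom_mulfI hR g0).
by rewrite mulr1 {2}gc ce mulrCA.
Qed.

End PrimeHeight.

(** * From a slice to fibres *)

Section TrivialBundle.
Variables (k : closedFieldType) (B : comAlgType k) (d : derivation B).
Hypotheses (char0 : forall n, n.+1%:R != 0 :> k)
  (hB : GRing.integral_domain_axiom B) (lnd : locally_nilpotent d).
Variables (s : B) (ds : slice d s).

Local Notation A := (derker d).
Local Notation incl := (derker_incl d).
Local Notation ev p := ((map_poly (derker_incl d) p).[s]).

(** Evaluating the coefficients of polynomials in s at the closed point m maps
    B onto k[t], with kernel the extension of m. *)
Lemma slice_fibre (m : idealr A) : finitely_generated A -> maximal_idealr m ->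
  fiber_is_A1 (incl : {lrmorphism A -> B}) m.
Proof.
move=> fgA max; have [chi [chik chim]] := maximal_point fgA max.
have [|Phi PhiE] := extend_at (slice_surj char0 lnd ds) (chi := polyC \o chi) (c := 'X).
  by move=> p /(slice_inj char0 ds)->; rewrite rmorph0 horner0.
have Phi_incl a : Phi (incl a) = (chi a)%:P.
  by have := PhiE a%:P; rewrite !map_polyC !hornerC.
have Phi_ev p : Phi (ev p) = map_poly chi p.
  by rewrite PhiE map_poly_comp -[RHS]comp_polyXr.
have [|||I hI] := @idealr_of B (fun b => Phi b = 0).
- exact: rmorph0.
- by rewrite rmorph1 => /eqP; rewrite oner_eq0.
- by move=> a x y ex ey; rewrite rmorphD rmorphM ex ey mulr0 addr0.
exists I => [b|].
  split=> [/hI|]; last first.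
    move=> h; apply/hI; apply: extended_ideal_vanish h => a.
    by rewrite Phi_incl -chim => /eqP ->.
  have [p ->] := slice_surj char0 lnd ds b; rewrite Phi_ev => p0.
  exists (size p), (fun i => p`_i), (fun i => s ^+ i); split=> [i|].
    by rewrite -chim -coef_map p0 coef0.
  rewrite (horner_coef_wide _ (size_poly _ _)).
  by apply: eq_bigr => i _; rewrite coef_map.
have [|g gE] := @quot_lift B I _ Phi; first by move=> b /hI.
have gZ : scalable g.
  move=> c y; have [b ->] := quot_pi_surj y.
  rewrite -quot_piZ !gE -mulr_algl rmorphM -mul_polyC; congr (_ * _).
  by rewrite -[c%:A](_ : incl c%:A = _) ?Phi_incl ?chik // linearZ /= rmorph1.
pose sc := GRing.isScalable.Build k _ _ _ g gZ.
pose G : {lrmorphism {ideal_quot I} -> {poly k}} :=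
  HB.pack (g : _ -> _) sc (GRing.RMorphism.on g).
exists G; apply: inj_surj_bij => [x y|q].
  have [[a ->] [b ->]] := (quot_pi_surj x, quot_pi_surj y).
  rewrite !gE => e; apply/eqP; rewrite -subr_eq0 -rmorphB quot_pi_eq0.
  by apply/hI; rewrite rmorphB e subrr.
exists (\pi_{ideal_quot I} (ev (map_poly (in_alg A) q))).
rewrite gE Phi_ev -map_poly_comp.
by apply/polyP => i; rewrite coef_map /= chik.
Qed.

(** If the derivative of p(s) is f q(s), then p' = f q, and p minus f times an
    antiderivative of q is a constant representing p(s) modulo f. *)
Lemma slice_tau_surj (f : A) (hf : ~ is_unit f) :
  forall y, exists x, y = tau hf x.
Proof.
move=> y; have [x ex] := quot_pi_surj (val y).
have /(@idealBE _ _ _ _ hf)[z ez] : d x \in idealB hf.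
  rewrite -quot_pi_eq0 -induced_funE -ex.
  by have := derkerE y => /eqP.
have [p ep] := slice_surj char0 lnd ds x; have [q eq] := slice_surj char0 lnd ds z.
have dp : p^`() = f *: q.
  apply/eqP; rewrite -subr_eq0; apply/eqP/(slice_inj char0 ds).
  rewrite rmorphB hornerD hornerN /= map_polyZ hornerZ /= -(der_slice ds) -ep ez eq.
  by rewrite subrr.
have [Q eQ] := antiderivative char0 q.
have ec : p = f *: Q + ((p - f *: Q)`_0)%:P.
  rewrite -(@deriv_eq0_const _ (p - f *: Q)); first by rewrite addrC subrK.
    by move=> n a; apply: (char0_torsion char0).
  by rewrite derivB derivZ eQ dp subrr.
exists (\pi_{ideal_quot (idealA hf)} ((p - f *: Q)`_0)); apply: val_inj.
rewrite tau_funE ex.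
apply/eqP; rewrite -Quotient.idealrBE; apply/idealBE; exists (ev Q).
rewrite ep {1}ec rmorphD hornerD /= map_polyZ hornerZ map_polyC hornerC.
by rewrite addrK.
Qed.

Lemma slice_birational (f : A) (hf : ~ is_unit f) : prime_elt (incl f) ->
  birational (tau hf).
Proof.
move=> fp; have hQB := @quotB_domain _ _ _ _ hf fp.
have inj := @quot_incl_inj _ _ _ _ hf hB fp.
apply: bijective_birational.
- exact: sub_domain hQB inj.
- exact: (sub_domain hQB (phi := val) val_inj).
- by move=> x y /(congr1 val)/inj.
- exact: slice_tau_surj.
Qed.

(** If every nonzero constant were invertible, B would be a polynomial ring in
    one variable over a field, in which nonzero primes are maximal. *)
Lemma slice_dim_le1 : (forall a : A, a != 0 -> is_unit a) -> ~ krull_dim_ge B 2.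
Proof.
move=> Aunit [p chain].
have [[_ n01] [s12 n12]] := (chain 0%N isT, chain 1%N isT).
pose pi1 : {rmorphism B -> {ideal_quot (p 1%N)}} := \pi_{ideal_quot (p 1%N)}.
have hE : GRing.integral_domain_axiom {ideal_quot (p 1%N)}.
  exact: Quotient.rquot_IdomainAxiom.
pose phi : {rmorphism A -> {ideal_quot (p 1%N)}} := pi1 \o incl.
have phi_inj : injective phi.
  move=> a b e; apply/eqP; rewrite -subr_eq0; apply/negPn/negP => /Aunit[c ec].
  have /eqP : phi ((a - b) * c) = 1 by rewrite ec rmorph1.
  by rewrite rmorphM rmorphB e subrr mul0r eq_sym oner_eq0.
have phiE (P : {poly A}) : (map_poly phi P).[pi1 s] = pi1 (ev P).
  by rewrite map_poly_comp horner_map.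
have [P mP] : exists P, minimal_at phi (pi1 s) P.
  apply: minimal_exists; apply: contrapT => np; apply: n01 => y yp1.
  have [P eP] := slice_surj char0 lnd ds y.
  have [P0|P0] := eqVneq P 0; first by rewrite eP P0 rmorph0 horner0 rpred0.
  case: np; exists P => //; rewrite phiE -eP.
  by apply/eqP; rewrite quot_pi_eq0.
apply: n12 => z zp2; apply/negPn/negP => zp1.
have [q ez] := slice_surj char0 lnd ds z.
have [|w [r [/Aunit[r' rr'] e]]] := alg_inverse hE phi_inj (p := q) mP.
  by rewrite phiE -ez quot_pi_eq0.
have : z * (ev w * incl r') - 1 \in p 1%N.
  rewrite -quot_pi_eq0 -[\pi _]/(pi1 _) rmorphB mulrA !rmorphM [X in pi1 X * _]ez.
  by rewrite -!phiE e -[pi1 (incl r')]/(phi r') -rmorphM rr' !rmorph1 subrr.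
move/s12 => h; have : z * (ev w * incl r') - (z * (ev w * incl r') - 1) \in p 2%N.
  by rewrite rpredB // mulrC idealMr.
by rewrite subKr idealr1.
Qed.

End TrivialBundle.

Theorem theorem3p5 (R : realType) (B : comAlgType R[i]) (delta : derivation B)
    (B_affine : affine_domain B)
    (B_factorial : factorial_ring B)
    (B_dim : krull_dim_ge B 3)
    (delta_lnd : locally_nilpotent delta)
    (delta_irr : irreducible_der delta)
    (A_affine : affine_domain (derker delta))
    (pi_fflat : faithfully_flat (derker_incl delta)) :
  trivial_A1_bundle (derker_incl delta) <->
  exists alpha : derker delta,
    [/\ codim_V alpha 1,
        forall m : idealr (derker delta), maximal_idealr m ->
          alpha \notin m -> fiber_is_A1 (derker_incl delta) m
      & forall (f : derker delta) (hf : prime_elt f), divides f alpha ->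
          birational (tau (prime_nonunit hf))].
Proof.
have char0 n : n.+1%:R != 0 :> R[i] by rewrite Num.Theory.pnatr_eq0.
have [fgB hB] := B_affine; have [fgA hA] := A_affine.
split=> [triv|[alpha [_ fib bir]]].
  have [s ds] := trivial_slice char0 hB delta_lnd delta_irr triv.
  have [a a0 au] : exists2 a : derker delta, a != 0 & ~ is_unit a.
    apply: contrapT => na; apply: (slice_dim_le1 char0 delta_lnd ds).
      by move=> a a0; apply: contrapT => au; apply: na; exists a.
    by have [p chain] := B_dim; exists p => i i2; apply: chain; apply: ltnW.
  have fact := derker_prime_factors char0 hB delta_lnd B_factorial.
  have [[|f l] [lp ea]] := fact a a0 au.
    by case: au; exists 1; rewrite ea big_nil mulr1.
  have fp := lp f (mem_head _ _).
  exists f; split=> [|m max _|g gp _].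
  - apply: codim_prime => //; first exact: (derker_prime hB).
    move=> b b0 bu; have [l' [l'p eb]] := fact b b0 bu; exists l'; split=> // g gl'.
    by apply: (derker_prime hB); apply: l'p.
  - exact: (slice_fibre (k := R[i]) char0 delta_lnd ds).
  - apply: (slice_birational (k := R[i]) char0 hB delta_lnd ds).
    exact: (prime_derker char0 hB delta_lnd B_factorial).
suff [s ds] : exists s, slice delta s by apply: (slice_trivial char0 delta_lnd ds).
apply: (slice_of_fractions (k := R[i])) => // f x fp fdx.
have [fa|fa] := pselect (divides f alpha).
  exact: (birational_fraction (k := R[i]) (bir f (derker_prime hB fp) fa) fdx).
have [b fdb] : exists b, ~ divides (derker_incl delta f) (delta b).
  apply: contrapT => nb; case: fp => _ fu _; apply: fu; apply: delta_irr => b.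
  by apply: contrapT => fdb; apply: nb; exists b.
have fu : ~ is_unit f by have [] := derker_prime hB fp.
exact: (generic_fibre_fraction fu char0 hB fp fgA fgB fib fa fdb fdx).
Qed.
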